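(* Let $n\ge 1$ and $N\ge 2$ be integers and let $0\le\lambda<\gamma\le\delta$. Then the equation $$r^n+\sum_{m=2}^{\infty}\frac{4(\gamma-\lambda)r^{nm}}{m^2[2\gamma+(\delta-\gamma)(m-1)]}+\sum_{m=N}^{\infty}\frac{4(\gamma-\lambda)r^m}{m^2[2\gamma+(\delta-\gamma)(m-1)]}-1-4(\gamma-\lambda)\sum_{m=2}^{\infty}\frac{(-1)^{m-1}}{m^2[2\gamma+(\delta-\gamma)(m-1)]}=0$$ has a unique root $R_{n,N}(\gamma,\delta,\lambda)$ in $(0,1)$, and for every $f=h+\overline{g}\in R_H^0(\gamma,\delta,\lambda)$, $$|f(z^n)|+\sum_{m=N}^{\infty}(|a_m|+|b_m|)|z|^m\le d(f(0),\partial f(\mathbb{D}))$$ for $|z|=r\le R_{n,N}(\gamma,\delta,\lambda)$. The radius $R_{n,N}(\gamma,\delta,\lambda)$ is the best possible.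
   Context: $\mathbb{D}$ is the open unit disk in $\mathbb{C}$. $\mathcal{H}_0$ is the set of complex-valued harmonic functions $f=h+\overline{g}$ on $\mathbb{D}$ with $h,g$ analytic, $h(0)=h'(0)-1=0$, $g(0)=g'(0)=0$; write $h(z)=z+\sum_{m=2}^\infty a_mz^m$, $g(z)=\sum_{m=2}^\infty b_mz^m$. For $0\le\lambda<\gamma\le\delta$, $R_H^0(\gamma,\delta,\lambda)$ is the class of all $f=h+\overline{g}\in\mathcal{H}_0$ satisfying, for all $z\in\mathbb{D}$, $$\mathrm{Re}\left(\gamma h'(z)+\delta zh''(z)+\tfrac{\delta-\gamma}{2}z^2h'''(z)-\lambda\right)>\left|\gamma g'(z)+\delta zg''(z)+\tfrac{\delta-\gamma}{2}z^2g'''(z)\right|.$$ $d(f(0),\partial f(\mathbb{D}))$ is the Euclidean distance from $f(0)$ to the boundary of $f(\mathbb{D})$. A radius being the best possible means that it cannot be replaced by any larger number in such a way that the inequality still holds for all functions in the class. *)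

(* Defs.v *)
From Stdlib Require Import Reals.
From Coquelicot Require Import Coquelicot.

Open Scope R_scope.

(* [@ex_derive C_AbsRing C_NormedModule] is complex differentiability. *)
Definition analytic_on_disk (h : C -> C) : Prop :=
  forall z : C, Cmod z < 1 -> @ex_derive C_AbsRing C_NormedModule h z.

Definition power_expansion (h : C -> C) (a : nat -> C) : Prop :=
  forall z : C, Cmod z < 1 -> @is_pseries C_AbsRing C_NormedModule a z (h z).

Definition harmonic_of (h g : C -> C) (z : C) : C := (h z + Cconj (g z))%C.

(* The coefficient sequences [a], [b] are determined by [h], [g]; the entries
   at 0 and 1 are fixed by the normalization. *)
Record class_H0 (h g : C -> C) (a b : nat -> C) : Prop := {
  H0_analytic_h : analytic_on_disk h;
  H0_analytic_g : analytic_on_disk g;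
  H0_h_0 : h (RtoC 0) = RtoC 0;
  H0_dh_0 : C_derive h (RtoC 0) = RtoC 1;
  H0_g_0 : g (RtoC 0) = RtoC 0;
  H0_dg_0 : C_derive g (RtoC 0) = RtoC 0;
  H0_expansion_h : power_expansion h a;
  H0_expansion_g : power_expansion g b }.

Definition third_order_op (gam del : R) (h : C -> C) (z : C) : C :=
  (RtoC gam * C_derive h z
   + RtoC del * z * C_derive (C_derive h) z
   + RtoC ((del - gam) / 2) * z ^ 2 * C_derive (C_derive (C_derive h)) z)%C.

Definition class_RH0 (gam del lam : R) (h g : C -> C) (a b : nat -> C) : Prop :=
  class_H0 h g a b /\
  forall z : C, Cmod z < 1 ->
    Re (third_order_op gam del h z - RtoC lam)%C
      > Cmod (third_order_op gam del g z).

Definition disk_image (f : C -> C) (w : C) : Prop :=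
  exists z : C, Cmod z < 1 /\ w = f z.

(* Points that are neither interior to [S] nor interior to its complement. *)
Definition boundary (S : C -> Prop) (w : C) : Prop :=
  ~ locally w S /\ ~ locally w (fun v => ~ S v).

(* Valued in [Rbar], so that the distance to the empty set is [p_infty]. *)
Definition dist_to (w : C) (S : C -> Prop) : Rbar :=
  Glb_Rbar (fun d => exists v : C, S v /\ d = Cmod (v - w)%C).

(* The sum of [u m] over [m >= k]. *)
Definition Series_from (k : nat) (u : nat -> R) : R :=
  Series (fun j => u (k + j)%nat).

Definition denom (gam del : R) (m : nat) : R :=
  INR m ^ 2 * (2 * gam + (del - gam) * (INR m - 1)).

Definition radius_function (n N : nat) (gam del lam r : R) : R :=
  r ^ n
  + Series_from 2 (fun m => 4 * (gam - lam) * r ^ (n * m) / denom gam del m)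
  + Series_from N (fun m => 4 * (gam - lam) * r ^ m / denom gam del m)
  - 1
  - 4 * (gam - lam) * Series_from 2 (fun m => (-1) ^ (m - 1) / denom gam del m).

Definition is_radius_root (n N : nat) (gam del lam r : R) : Prop :=
  0 < r < 1 /\ radius_function n N gam del lam r = 0.

Definition bohr_inequality (n N : nat) (h g : C -> C) (a b : nat -> C) (z : C)
    : Prop :=
  let f := harmonic_of h g in
  Rbar_le
    (Finite (Cmod (f (z ^ n)%C)
             + Series_from N (fun m => (Cmod (a m) + Cmod (b m)) * Cmod z ^ m)))
    (dist_to (f (RtoC 0)) (boundary (disk_image f))).

Definition bohr_holds_up_to (n N : nat) (gam del lam rho : R) : Prop :=
  forall (h g : C -> C) (a b : nat -> C), class_RH0 gam del lam h g a b ->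
  forall z : C, Cmod z < 1 -> Cmod z <= rho -> bohr_inequality n N h g a b z.

(* Main.v *)
Require Import Defs.
From Stdlib Require Import Reals Lra Lia.
From Coquelicot Require Import Coquelicot.

(** Write [op] for the third-order operator of the class, [d_m] for
    [denom gam del m] and [G] for
    [1 + 4 (gam - lam) * Sum_{m >= 2} (-1)^(m-1) / d_m], called
    [covering_radius] below. The equation defining the radius says that
    [r^n], plus the two series obtained by replacing [|a_m| + |b_m|] by
    [4 (gam - lam) / d_m], equals [G], and all these terms increase with [r]. So
    the theorem follows from two facts:
    the coefficient bound [|a_m| + |b_m| <= 4 (gam - lam) / d_m], and the
    distance bound [d(f(0), boundary of f(D)) >= G], both attained by
    [z + Sum_{m >= 2} 4 (gam - lam) z^m / d_m].

    The operator multiplies the coefficient of [z^m] by [d_m / 2] (and shifts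
    the index), so for unimodular [e] the class condition says that
    [op(h + e g) - lam] has coefficients
    [P_0 = gam - lam], [P_k = (d_{k+1} / 2) (a_{k+1} + e b_{k+1})] and positive
    real part. Everything known about such a series comes from one inequality,
    [positive_pairing]: two series whose real parts are non-negative on the unit
    circle have a non-negative Parseval pairing. Pairing with [1 + u w^k] gives
    the Caratheodory bound [|P_k| <= 2 P_0], hence the coefficient bound.
    Pairing with a modified Poisson kernel gives lower bounds for
    [Re ((h + e g)(z) / z)] and [Re (h + e g)'(z)]. Those kernels are obtained
    from the Poisson kernel by dividing its [k]-th coefficient by
    [2 gam + (del - gam) k] and by [k + 1] (twice for the first bound, once for
    the second). Dividing by [al + be k] inverts the differential operator
    [al + be s d/ds], and this inversion preserves lower bounds because of what
    the operator does at a minimum ([nonneg_of_euler_op]). The alternating sum in [G] comes from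
    the value of the kernel at [-1], where it is smallest.

    For the distance, take [e = z / conj z] in the first lower bound: it becomes
    [Re (conj z * f z) >= G |z|^2]. In the same way the second one becomes strong
    monotonicity of [f] on every smaller disk. A strongly monotone Lipschitz map
    pointing outwards in this quantitative sense is onto: the iteration
    [z - tau (f z - w)] contracts a disk into itself
    ([strongly_monotone_onto]). Hence [f(D)] contains the open disk of radius
    [G], and no boundary point lies in it.

    For sharpness, the extremal map has real coefficients and is injective, so
    its image meets the real line only in the image of the diameter, on which it
    increases with limit [- G] at [-1]. Hence [- G] is a boundary point, and for
    [z = r] beyond the root the left-hand side of the inequality, computed
    exactly, exceeds [G]. *)

Open Scope R_scope.

(** * Complex series and power series on the unit disk *)

Lemma C_eq (x y : C) : Re x = Re y -> Im x = Im y -> x = y.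
Proof. destruct x, y; unfold Re, Im; simpl; intros; now f_equal. Qed.

Lemma Cconj_RtoC (r : R) : Cconj (RtoC r) = RtoC r.
Proof. apply C_eq; unfold Re, Im; simpl; ring. Qed.

Lemma Re_sum_n (u : nat -> C) n :
  Re (sum_n u n) = sum_n (fun k => Re (u k)) n.
Proof.
induction n as [|n IH]; [now rewrite !sum_O|].
rewrite !sum_Sn, <- IH. reflexivity.
Qed.

Lemma Im_sum_n (u : nat -> C) n :
  Im (sum_n u n) = sum_n (fun k => Im (u k)) n.
Proof.
induction n as [|n IH]; [now rewrite !sum_O|].
rewrite !sum_Sn, <- IH. reflexivity.
Qed.

Definition is_Cseries (u : nat -> C) (l : C) : Prop :=
  @is_series C_AbsRing C_NormedModule u l.

Lemma is_Cseries_iff (u : nat -> C) (l : C) :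
  is_Cseries u l <->
  is_series (fun k => Re (u k)) (Re l) /\ is_series (fun k => Im (u k)) (Im l).
Proof.
split.
- intros H; split.
  + unfold is_series.
    eapply filterlim_ext; [intros n; apply Re_sum_n|].
    eapply filterlim_comp; [exact H|]. apply (continuous_fst (fst l) (snd l)).
  + unfold is_series.
    eapply filterlim_ext; [intros n; apply Im_sum_n|].
    eapply filterlim_comp; [exact H|]. apply (continuous_snd (fst l) (snd l)).
- intros [H1 H2]. unfold is_Cseries, is_series.
  intros P [eps HP].
  assert (E1 := proj1 (filterlim_locally _ _) H1 eps).
  assert (E2 := proj1 (filterlim_locally _ _) H2 eps).
  unfold filtermap.
  eapply filter_imp; [|exact (filter_and _ _ E1 E2)].
  intros n [B1 B2]. apply HP. split.
  + rewrite <- Re_sum_n in B1. exact B1.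
  + rewrite <- Im_sum_n in B2. exact B2.
Qed.

Definition Cseries (u : nat -> C) : C :=
  (Series (fun k => Re (u k)), Series (fun k => Im (u k))).

Lemma is_Cseries_unique (u : nat -> C) (l : C) : is_Cseries u l -> Cseries u = l.
Proof.
rewrite is_Cseries_iff; intros [H1 H2].
apply C_eq; simpl; now apply is_series_unique.
Qed.

Lemma Cseries_ext (u v : nat -> C) : (forall k, u k = v k) -> Cseries u = Cseries v.
Proof.
intros H; unfold Cseries; f_equal; apply Series_ext; intros k; now rewrite H.
Qed.

Lemma is_Cseries_ext (u v : nat -> C) l :
  (forall k, u k = v k) -> is_Cseries u l -> is_Cseries v l.
Proof. intros H; apply is_series_ext; exact H. Qed.

Lemma is_Cseries_abs (u : nat -> C) :
  ex_series (fun k => Cmod (u k)) -> is_Cseries u (Cseries u).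
Proof.
intros H.
destruct (@ex_series_le C_AbsRing C_CompleteNormedModule u (fun k => Cmod (u k)))
  as [l Hl]; [intros k; apply Rle_refl|exact H|].
assert (Hl' : is_Cseries u l) by exact Hl.
now rewrite (is_Cseries_unique _ _ Hl').
Qed.

Lemma is_Cseries_plus (u v : nat -> C) x y :
  is_Cseries u x -> is_Cseries v y ->
  is_Cseries (fun k => u k + v k)%C (x + y)%C.
Proof. intros; now apply (is_series_plus (V := C_NormedModule)). Qed.

Lemma is_Cseries_scal (c : C) (u : nat -> C) x :
  is_Cseries u x -> is_Cseries (fun k => c * u k)%C (c * x)%C.
Proof. intros; now apply (is_series_scal (V := C_NormedModule) c). Qed.

Lemma is_Cseries_conj (u : nat -> C) x :
  is_Cseries u x -> is_Cseries (fun k => Cconj (u k)) (Cconj x).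
Proof.
rewrite !is_Cseries_iff; intros [H1 H2]; split.
- exact H1.
- exact (is_series_opp _ _ H2).
Qed.

Lemma is_Cseries_Re (u : nat -> C) x :
  is_Cseries u x -> is_series (fun k => Re (u k)) (Re x).
Proof. rewrite is_Cseries_iff; tauto. Qed.

Lemma ex_series_nonneg_le (u v : nat -> R) :
  (forall k, 0 <= u k <= v k) -> ex_series v -> ex_series u.
Proof.
intros H Hv. apply (ex_series_le (V := R_CompleteNormedModule) u v); [|exact Hv].
intros k; change (Rabs (u k) <= v k). rewrite Rabs_pos_eq; apply H.
Qed.

Lemma ex_series_mult_l (c : R) (u : nat -> R) :
  ex_series u -> ex_series (fun k => c * u k).
Proof. exact (ex_series_scal (V := R_NormedModule) c u). Qed.

Lemma ex_series_Re (u : nat -> C) :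
  ex_series (fun k => Cmod (u k)) -> ex_series (fun k => Re (u k)).
Proof.
intros H. exists (Re (Cseries u)). now apply is_Cseries_Re, is_Cseries_abs.
Qed.

(** Rotating [z] onto the positive axis turns statements about a modulus into
    statements about a real part, without a polar decomposition. *)
Lemma unimodular_phase (z : C) :
  exists c : C, Cmod c = 1 /\ (c * z)%C = RtoC (Cmod z).
Proof.
destruct (Req_dec (Cmod z) 0) as [H|H].
- exists (RtoC 1). rewrite Cmod_1. split; [easy|].
  rewrite (Cmod_eq_0 _ H), Cmod_0. ring.
- exists (Cconj z / RtoC (Cmod z))%C.
  assert (Hn : RtoC (Cmod z) <> RtoC 0) by (intros E; apply H; now apply RtoC_inj).
  split.
  + rewrite Cmod_div, Cmod_conj, Cmod_R, Rabs_pos_eq by (auto using Cmod_ge_0).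
    now field.
  + replace (Cconj z / Cmod z * z)%C with (z * Cconj z / Cmod z)%C by (field; auto).
    rewrite <- Cmod2_conj. rewrite RtoC_pow. simpl. field; auto.
Qed.

Lemma Cmod_is_Cseries_le (u : nat -> C) (l : C) :
  is_Cseries u l -> ex_series (fun k => Cmod (u k)) ->
  Cmod l <= Series (fun k => Cmod (u k)).
Proof.
intros Hu Hs. destruct (unimodular_phase l) as [c [Hc E]].
assert (H := is_Cseries_Re _ _ (is_Cseries_scal c _ _ Hu)).
rewrite E, re_RtoC in H.
rewrite <- (is_series_unique _ _ H).
assert (Hb : forall k, Rabs (Re (c * u k)) <= Cmod (u k)).
{ intros k. generalize (re_le_Cmod (c * u k)). rewrite Cmod_mult, Hc; lra. }
eapply Rle_trans; [apply Rle_abs|].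
assert (He : ex_series (fun k => Rabs (Re (c * u k)))).
{ apply ex_series_nonneg_le with (2 := Hs). intros k; split; [apply Rabs_pos|apply Hb]. }
eapply Rle_trans; [apply Series_Rabs, He|].
apply Series_le; [|exact Hs]. intros k; split; [apply Rabs_pos|apply Hb].
Qed.

Lemma pow_n_Cpow (z : C) k : @pow_n C_Ring z k = (z ^ k)%C.
Proof. induction k as [|k IH]; simpl; [reflexivity|]. now rewrite <- IH. Qed.

Lemma power_expansion_iff (h : C -> C) (a : nat -> C) :
  power_expansion h a <->
  forall z, Cmod z < 1 -> is_Cseries (fun k => a k * z ^ k)%C (h z).
Proof.
unfold power_expansion, is_pseries.
split; intros H z Hz; specialize (H z Hz); revert H; apply is_series_ext; intros k;
  rewrite <- pow_n_Cpow; [apply Cmult_comm|apply (Cmult_comm (a k))].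
Qed.

Definition disk_summable (a : nat -> C) : Prop :=
  forall r, 0 <= r < 1 -> ex_series (fun k => Cmod (a k) * r ^ k).

Lemma is_Cseries_bounded (u : nat -> C) l :
  is_Cseries u l -> exists M, forall k, Cmod (u k) <= M.
Proof.
rewrite is_Cseries_iff; intros [H1 H2].
assert (B : forall v : nat -> R, ex_series v -> exists M, forall k, Rabs (v k) <= M).
{ intros v Hv. assert (Hl := ex_series_lim_0 _ Hv).
  assert (Hc := proj1 (is_lim_seq_Reals _ _) Hl).
  destruct (maj_by_pos v (exist _ _ Hc)) as [M [_ HM]]. now exists M. }
destruct (B _ (ex_intro _ _ H1)) as [M1 HM1].
destruct (B _ (ex_intro _ _ H2)) as [M2 HM2].
exists (M1 + M2). intros k. specialize (HM1 k); specialize (HM2 k).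
assert (T : Cmod (u k) <= Rabs (Re (u k)) + Rabs (Im (u k))).
{ replace (u k) with (RtoC (Re (u k)) + Ci * RtoC (Im (u k)))%C at 1
    by (apply C_eq; unfold Re, Im; simpl; ring).
  eapply Rle_trans; [apply Cmod_triangle|].
  rewrite Cmod_mult, Cmod_Ci, !Cmod_R. lra. }
lra.
Qed.

(** Convergence at a point [s] with [r < s < 1] bounds the terms there, and the
    ratio [r / s] makes the series at radius [r] geometrically dominated. *)
Lemma power_expansion_summable (h : C -> C) (a : nat -> C) :
  power_expansion h a -> disk_summable a.
Proof.
rewrite power_expansion_iff. intros H r Hr.
set (s := (1 + r) / 2).
assert (Hs : 0 < s < 1 /\ r < s) by (unfold s; lra).
destruct (is_Cseries_bounded _ _ (H (RtoC s) ltac:(rewrite Cmod_R, Rabs_pos_eq; lra)))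
  as [M HM].
apply ex_series_nonneg_le with (fun k => M * (r / s) ^ k).
- intros k. split.
  + apply Rmult_le_pos; [apply Cmod_ge_0|now apply pow_le].
  + specialize (HM k). rewrite Cmod_mult, Cmod_pow, Cmod_R, Rabs_pos_eq in HM by lra.
    replace r with (s * (r / s)) at 1 by (field; lra).
    rewrite Rpow_mult_distr, <- Rmult_assoc.
    apply Rmult_le_compat_r; [|exact HM]. apply pow_le.
    apply Rdiv_le_0_compat; lra.
- apply (ex_series_mult_l M). apply ex_series_geom.
  rewrite Rabs_pos_eq by (apply Rdiv_le_0_compat; lra).
  apply Rmult_lt_reg_r with s; [lra|]. unfold Rdiv. rewrite Rmult_assoc, Rinv_l; lra.
Qed.

Lemma disk_summable_CV_radius (a : nat -> C) x :
  disk_summable a -> Rabs x < 1 -> Rbar_lt (Rabs x) (CV_radius (fun k => Cmod (a k))).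
Proof.
intros H Hx. set (s := (1 + Rabs x) / 2).
assert (Hs : Rabs x < s < 1) by (unfold s; lra).
assert (H0 := Rabs_pos x).
apply Rbar_lt_le_trans with s; [exact (proj1 Hs)|].
apply (CV_radius_bounded (fun k => Cmod (a k))).
destruct (is_Cseries_bounded (fun k => a k * RtoC s ^ k)%C
  (Cseries (fun k => a k * RtoC s ^ k)%C)) as [M HM].
{ apply is_Cseries_abs. eapply ex_series_ext; [|apply (H s); lra].
  intros k. rewrite Cmod_mult, Cmod_pow, Cmod_R, (Rabs_pos_eq s); lra. }
exists M. intros k. specialize (HM k).
rewrite Cmod_mult, Cmod_pow, Cmod_R in HM.
rewrite Rabs_mult, <- RPow_abs, (Rabs_pos_eq (Cmod _)) by apply Cmod_ge_0. exact HM.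
Qed.

Lemma CV_radius_disk_summable (a : nat -> C) :
  (forall x, Rabs x < 1 -> Rbar_lt (Rabs x) (CV_radius (fun k => Cmod (a k)))) ->
  disk_summable a.
Proof.
intros H r Hr.
assert (Hx := CV_disk_inside _ r (H r ltac:(rewrite Rabs_pos_eq; lra))).
eapply ex_series_ext; [|exact Hx]. intros k. apply Rabs_pos_eq.
apply Rmult_le_pos; [apply Cmod_ge_0|]. apply pow_le; lra.
Qed.

Lemma disk_summable_le (a b : nat -> C) M :
  (forall k, Cmod (b k) <= M * Cmod (a k)) -> disk_summable a -> disk_summable b.
Proof.
intros H Ha r Hr. apply ex_series_nonneg_le with (fun k => M * (Cmod (a k) * r ^ k)).
- intros k. assert (0 <= r ^ k) by (apply pow_le; lra). split.
  + apply Rmult_le_pos; auto using Cmod_ge_0.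
  + rewrite <- Rmult_assoc. now apply Rmult_le_compat_r.
- apply (ex_series_mult_l M). now apply Ha.
Qed.

Lemma disk_summable_plus (a b : nat -> C) :
  disk_summable a -> disk_summable b -> disk_summable (fun k => a k + b k)%C.
Proof.
intros Ha Hb r Hr.
apply ex_series_nonneg_le with (fun k => Cmod (a k) * r ^ k + Cmod (b k) * r ^ k).
- intros k. assert (0 <= r ^ k) by (apply pow_le; lra). split.
  + apply Rmult_le_pos; auto using Cmod_ge_0.
  + rewrite <- Rmult_plus_distr_r. apply Rmult_le_compat_r; [easy|apply Cmod_triangle].
- now apply (ex_series_plus (V := R_NormedModule)); [apply Ha|apply Hb].
Qed.

Definition Cderiv_coef (a : nat -> C) (k : nat) : C := (RtoC (INR (S k)) * a (S k))%C.

(** The moduli form a real power series with radius of convergence at least 1,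
    and real termwise differentiation keeps the radius. *)
Lemma disk_summable_deriv (a : nat -> C) :
  disk_summable a -> disk_summable (Cderiv_coef a).
Proof.
intros H. apply CV_radius_disk_summable. intros x Hx.
rewrite (CV_radius_ext _ (PS_derive (fun k => Cmod (a k)))).
- rewrite CV_radius_derive. now apply disk_summable_CV_radius.
- intros k. unfold Cderiv_coef, PS_derive.
  rewrite Cmod_mult, Cmod_R, Rabs_pos_eq by apply pos_INR. reflexivity.
Qed.

Lemma disk_summable_at (a : nat -> C) z :
  disk_summable a -> Cmod z < 1 -> ex_series (fun k => Cmod (a k * z ^ k)).
Proof.
intros H Hz. eapply ex_series_ext; [|apply (H (Cmod z))]; [|split; [apply Cmod_ge_0|exact Hz]].
intros k. now rewrite Cmod_mult, Cmod_pow.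
Qed.

(** Summing real and imaginary parts separately gives a total function, so
    that a power series can be handled without a convergence proof attached. *)
Definition Cpseries (a : nat -> C) (z : C) : C := Cseries (fun k => a k * z ^ k)%C.

Lemma is_Cpseries (a : nat -> C) z :
  disk_summable a -> Cmod z < 1 ->
  is_Cseries (fun k => a k * z ^ k)%C (Cpseries a z).
Proof. intros; now apply is_Cseries_abs, disk_summable_at. Qed.

(** * Termwise differentiation *)

Lemma Cpow_diff_bound (z w : C) r k :
  Cmod z <= r -> Cmod w <= r ->
  Cmod (z ^ S k - w ^ S k)%C <= INR (S k) * r ^ k * Cmod (z - w)%C.
Proof.
intros Hz Hw. assert (Hr : 0 <= r) by (generalize (Cmod_ge_0 z); lra).
induction k as [|k IH].
- simpl. replace (z * 1 - w * 1)%C with (z - w)%C by ring. lra.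
- replace (z ^ S (S k) - w ^ S (S k))%C
    with (z * (z ^ S k - w ^ S k) + w ^ S k * (z - w))%C by (simpl; ring).
  eapply Rle_trans; [apply Cmod_triangle|]. rewrite !Cmod_mult, Cmod_pow.
  assert (X : Cmod z * Cmod (z ^ S k - w ^ S k)%C
              <= r * (INR (S k) * r ^ k * Cmod (z - w))).
  { apply Rmult_le_compat; auto using Cmod_ge_0. }
  assert (Y : Cmod w ^ S k * Cmod (z - w) <= r ^ S k * Cmod (z - w)).
  { apply Rmult_le_compat_r; [apply Cmod_ge_0|]. apply pow_incr. split; auto using Cmod_ge_0. }
  rewrite (S_INR (S k)). simpl pow in *. nra.
Qed.

Lemma Cpow_taylor_bound (z w : C) r k :
  Cmod z <= r -> Cmod w <= r ->
  Cmod (z ^ S (S k) - w ^ S (S k) - RtoC (INR (S (S k))) * w ^ S k * (z - w))%C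
    <= INR (S (S k)) * INR (S k) * r ^ k * Cmod (z - w)%C ^ 2.
Proof.
intros Hz Hw. assert (Hr : 0 <= r) by (generalize (Cmod_ge_0 z); lra).
induction k as [|k IH].
- replace (z ^ 2 - w ^ 2 - RtoC (INR 2) * w ^ 1 * (z - w))%C with ((z - w) ^ 2)%C.
  2:{ replace (INR 2) with (1 + 1) by (simpl; ring). rewrite RtoC_plus. simpl; ring. }
  rewrite Cmod_pow. simpl. generalize (pow2_ge_0 (Cmod (z - w))). simpl. nra.
- replace (z ^ S (S (S k)) - w ^ S (S (S k))
           - RtoC (INR (S (S (S k)))) * w ^ S (S k) * (z - w))%C
    with (w * (z ^ S (S k) - w ^ S (S k) - RtoC (INR (S (S k))) * w ^ S k * (z - w))
          + (z ^ S (S k) - w ^ S (S k)) * (z - w))%C.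
  2:{ rewrite (S_INR (S (S k))), RtoC_plus. simpl; ring. }
  eapply Rle_trans; [apply Cmod_triangle|]. rewrite !(Cmod_mult w), (Cmod_mult (_ - _)).
  assert (D := Cpow_diff_bound z w r (S k) Hz Hw).
  assert (X : Cmod w * Cmod (z ^ S (S k) - w ^ S (S k)
                 - RtoC (INR (S (S k))) * w ^ S k * (z - w))%C
     <= r * (INR (S (S k)) * INR (S k) * r ^ k * Cmod (z - w)%C ^ 2)).
  { apply Rmult_le_compat; auto using Cmod_ge_0. }
  assert (Y : Cmod (z ^ S (S k) - w ^ S (S k))%C * Cmod (z - w)
     <= INR (S (S k)) * r ^ S k * Cmod (z - w) * Cmod (z - w)).
  { apply Rmult_le_compat_r; auto using Cmod_ge_0. }
  assert (P : 0 <= INR (S (S k)) * (r * r ^ k * Cmod (z - w) ^ 2)).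
  { assert (0 <= r ^ k) by now apply pow_le.
    apply Rmult_le_pos; [apply pos_INR|]. apply Rmult_le_pos; [|apply pow2_ge_0]. nra. }
  replace (INR (S (S (S k)))) with (INR (S k) + 2) by (rewrite !S_INR; ring).
  simpl pow in *. nra.
Qed.

Lemma is_Cseries_decr (u : nat -> C) l :
  is_Cseries u l -> is_Cseries (fun k => u (S k)) (l - u O)%C.
Proof.
intros H. apply (is_series_incr_1 (V := C_NormedModule)).
change (is_Cseries u (l - u O + u O)%C).
replace (l - u O + u O)%C with l by ring. exact H.
Qed.

(** A quadratic remainder estimate, uniform on each smaller disk. It serves
    three purposes: complex differentiability, the Lipschitz bound and the
    derivative along segments. *)
Lemma Cpseries_taylor (a : nat -> C) r :
  disk_summable a -> 0 <= r < 1 ->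
  exists K, 0 <= K /\ forall z w, Cmod z <= r -> Cmod w <= r ->
    Cmod (Cpseries a z - Cpseries a w - Cpseries (Cderiv_coef a) w * (z - w))%C
      <= K * Cmod (z - w)%C ^ 2.
Proof.
intros Ha Hr. set (b := Cderiv_coef (Cderiv_coef a)).
assert (Hb : disk_summable b) by now apply disk_summable_deriv, disk_summable_deriv.
assert (Hnn : forall k, 0 <= Cmod (b k) * r ^ k).
{ intros k; apply Rmult_le_pos; [apply Cmod_ge_0|apply pow_le; lra]. }
exists (Series (fun k => Cmod (b k) * r ^ k)). split.
{ rewrite <- (Rmult_0_l (Series (fun _ : nat => 0))), <- Series_scal_l.
  apply Series_le; [intros k; split; [lra|]|now apply Hb].
  rewrite Rmult_0_l; apply Hnn. }
intros z w Hz Hw.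
assert (Hz1 : Cmod z < 1) by lra. assert (Hw1 : Cmod w < 1) by lra.
assert (S1 := is_Cseries_decr _ _ (is_Cpseries a z Ha Hz1)).
assert (S2 := is_Cseries_decr _ _ (is_Cpseries a w Ha Hw1)).
assert (S3 := is_Cpseries _ w (disk_summable_deriv a Ha) Hw1).
assert (S4 := is_Cseries_decr _ _ (is_Cseries_plus _ _ _ _ (is_Cseries_plus _ _ _ _ S1
    (is_Cseries_scal (-(1))%C _ _ S2)) (is_Cseries_scal (- (z - w))%C _ _ S3))).
match type of S4 with is_Cseries ?u ?l => set (v := u) in S4; set (m := l) in S4 end.
replace (Cpseries a z - Cpseries a w - Cpseries (Cderiv_coef a) w * (z - w))%C with m.
2:{ unfold m, Cderiv_coef. simpl. ring. }
assert (Hv : forall k, 0 <= Cmod (v k) <= Cmod (b k) * r ^ k * Cmod (z - w)%C ^ 2).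
{ intros k. split; [apply Cmod_ge_0|].
  replace (v k) with (a (S (S k)) * (z ^ S (S k) - w ^ S (S k)
              - RtoC (INR (S (S k))) * w ^ S k * (z - w)))%C
    by (unfold v, Cderiv_coef; ring).
  rewrite Cmod_mult. unfold b, Cderiv_coef.
  rewrite !Cmod_mult, !Cmod_R, !Rabs_pos_eq by apply pos_INR.
  eapply Rle_trans; [apply Rmult_le_compat_l;
    [apply Cmod_ge_0|apply (Cpow_taylor_bound z w r k Hz Hw)]|].
  apply Req_le; ring. }
assert (He : ex_series (fun k => Cmod (b k) * r ^ k * Cmod (z - w)%C ^ 2)).
{ apply ex_series_ext with (fun k => Cmod (z - w)%C ^ 2 * (Cmod (b k) * r ^ k)).
  - intros k; apply Rmult_comm.
  - apply ex_series_mult_l. now apply Hb. }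
eapply Rle_trans.
{ apply Cmod_is_Cseries_le; [exact S4|]. now apply ex_series_nonneg_le with (1 := Hv). }
eapply Rle_trans; [apply Series_le; [exact Hv|exact He]|].
rewrite Series_scal_r. lra.
Qed.

Lemma locally_Cmod (z : C) (P : C -> Prop) :
  locally z P <-> exists d, 0 < d /\ forall y, Cmod (y - z)%C < d -> P y.
Proof.
split.
- intros H.
  destruct (locally_norm_le_locally (V := C_NormedModule) z P H) as [d Hd].
  exists d. split; [apply cond_pos|]. intros y Hy. apply Hd. exact Hy.
- intros [d [Hd H]]. apply (locally_le_locally_norm (V := C_NormedModule) z P).
  exists (mkposreal d Hd). intros y Hy. apply H. exact Hy.
Qed.

(** Stated for the neighbourhoods given by the modulus, since these are the ones
    over which complex derivatives are taken; the product neighbourhoods of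
    [C] are covered by [locally_Cmod]. *)
Lemma locally_disk (z : C) :
  Cmod z < 1 -> @locally (AbsRing_UniformSpace C_AbsRing) z (fun y => Cmod y < 1).
Proof.
intros Hz. assert (Hd : 0 < 1 - Cmod z) by lra.
exists (mkposreal _ Hd). intros y Hy. change (Cmod (y - z)%C < 1 - Cmod z) in Hy.
replace y with (z + (y - z))%C by ring.
eapply Rle_lt_trans; [apply Cmod_triangle|]. lra.
Qed.

Lemma Cpseries_is_derive (a : nat -> C) z :
  disk_summable a -> Cmod z < 1 ->
  @is_derive C_AbsRing C_NormedModule (Cpseries a) z (Cpseries (Cderiv_coef a) z).
Proof.
intros Ha Hz. split; [apply is_linear_scal_l|].
intros x Hx. assert (E := is_filter_lim_locally_unique (V := AbsRing_NormedModule C_AbsRing) z x Hx). subst x. intros eps.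
set (r := (1 + Cmod z) / 2).
assert (Hr : Cmod z < r < 1) by (unfold r; lra).
destruct (Cpseries_taylor a r Ha) as [K [HK HT]]; [generalize (Cmod_ge_0 z); lra|].
assert (He := cond_pos eps).
assert (Hd : 0 < Rmin (r - Cmod z) (eps / (K + 1))).
{ apply Rmin_pos; [lra|]. apply Rdiv_lt_0_compat; lra. }
exists (mkposreal _ Hd). intros y Hy. change (Cmod (y - z)%C < Rmin (r - Cmod z) (eps / (K + 1))) in Hy.
assert (Hy1 : Cmod (y - z) < r - Cmod z) by (eapply Rlt_le_trans; [exact Hy|apply Rmin_l]).
assert (Hy2 : Cmod (y - z) < eps / (K + 1)) by (eapply Rlt_le_trans; [exact Hy|apply Rmin_r]).
assert (Hyr : Cmod y <= r).
{ replace y with (z + (y - z))%C by ring.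
  eapply Rle_trans; [apply Cmod_triangle|]. lra. }
specialize (HT y z Hyr (Rlt_le _ _ (proj1 Hr))).
change (Cmod (Cpseries a y - Cpseries a z - (y - z) * Cpseries (Cderiv_coef a) z)%C
        <= eps * Cmod (y - z)%C).
rewrite (Cmult_comm (y - z)). eapply Rle_trans; [exact HT|].
assert (H0 := Cmod_ge_0 (y - z)).
assert (K * Cmod (y - z) <= eps).
{ apply Rmult_lt_compat_r with (r := K + 1) in Hy2; [|lra].
  unfold Rdiv in Hy2. rewrite Rmult_assoc, Rinv_l in Hy2; nra. }
simpl. nra.
Qed.

Lemma power_expansion_eq (h : C -> C) a z :
  power_expansion h a -> Cmod z < 1 -> h z = Cpseries a z.
Proof.
rewrite power_expansion_iff. intros H Hz. symmetry. now apply is_Cseries_unique, H.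
Qed.

Lemma power_expansion_is_derive (h : C -> C) a z :
  power_expansion h a -> Cmod z < 1 ->
  @is_derive C_AbsRing C_NormedModule h z (Cpseries (Cderiv_coef a) z).
Proof.
intros H Hz.
apply is_derive_ext_loc with (Cpseries a).
- generalize (locally_disk z Hz). apply filter_imp.
  intros y Hy. symmetry. now apply power_expansion_eq.
- apply Cpseries_is_derive; [|exact Hz]. now apply power_expansion_summable with h.
Qed.

Lemma C_derive_power_expansion (h : C -> C) a z :
  power_expansion h a -> Cmod z < 1 -> C_derive h z = Cpseries (Cderiv_coef a) z.
Proof. intros; now apply is_C_derive_unique, power_expansion_is_derive. Qed.

Lemma power_expansion_derive (h : C -> C) a :
  power_expansion h a -> power_expansion (C_derive h) (Cderiv_coef a).
Proof.
intros H. apply power_expansion_iff. intros z Hz.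
rewrite (C_derive_power_expansion h a z H Hz).
apply is_Cpseries; [|exact Hz].
now apply disk_summable_deriv, power_expansion_summable with h.
Qed.

Lemma is_Cseries_incr (u : nat -> C) l :
  is_Cseries (fun k => u (S k)) l -> u O = RtoC 0 -> is_Cseries u l.
Proof.
intros H H0. apply (is_series_decr_1 (V := C_NormedModule)).
change (is_Cseries (fun k => u (S k)) (l + - u O)%C).
rewrite H0. replace (l + - 0)%C with l by ring. exact H.
Qed.

(** * The third-order operator on coefficients *)

(** On [z^(k+1)] the operator acts as multiplication by
    [(k+1) (gam + del k + (del - gam) / 2 * k (k - 1))] followed by division by
    [z], and this factor is [denom gam del (k+1) / 2]. *)
Definition op_coef (gam del : R) (a : nat -> C) (k : nat) : C :=
  (RtoC (denom gam del (S k) / 2) * a (S k))%C.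

Lemma third_order_op_expansion gam del (h : C -> C) a :
  power_expansion h a -> power_expansion (third_order_op gam del h) (op_coef gam del a).
Proof.
intros H0.
assert (H1 := power_expansion_derive _ _ H0).
assert (H2 := power_expansion_derive _ _ H1).
assert (H3 := power_expansion_derive _ _ H2).
rewrite power_expansion_iff in H1, H2, H3.
apply power_expansion_iff. intros z Hz.
specialize (H1 z Hz); specialize (H2 z Hz); specialize (H3 z Hz).
(* Multiplying by z or z^2 shifts the index; the factors k and k - 1 vanish at
   the terms gained by the shift. *)
assert (G2 : is_Cseries (fun k => RtoC (INR k * INR (S k)) * a (S k) * z ^ k)%C
               (z * C_derive (C_derive h) z)).
{ apply is_Cseries_incr; [|simpl; rewrite Rmult_0_l; ring].
  eapply is_Cseries_ext; [|apply (is_Cseries_scal z), H2].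
  intros k. unfold Cderiv_coef. rewrite RtoC_mult. simpl Cpow. ring. }
assert (G3 : is_Cseries
   (fun k => RtoC ((INR k - 1) * INR k * INR (S k)) * a (S k) * z ^ k)%C
               (z ^ 2 * C_derive (C_derive (C_derive h)) z)).
{ apply is_Cseries_incr; [apply is_Cseries_incr|].
  - eapply is_Cseries_ext; [|apply (is_Cseries_scal (z ^ 2)), H3].
    intros k. unfold Cderiv_coef.
    replace (INR (S (S k)) - 1) with (INR (S k)) by (rewrite (S_INR (S k)); ring).
    rewrite !RtoC_mult. simpl Cpow. ring.
  - replace ((INR 1 - 1) * INR 1 * INR 2) with 0 by (simpl; ring). ring.
  - replace ((INR 0 - 1) * INR 0 * INR 1) with 0 by (simpl; ring). ring. }
assert (G := is_Cseries_plus _ _ _ _ (is_Cseries_plus _ _ _ _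
   (is_Cseries_scal (RtoC gam) _ _ H1) (is_Cseries_scal (RtoC del) _ _ G2))
   (is_Cseries_scal (RtoC ((del - gam) / 2)) _ _ G3)).
unfold third_order_op.
match type of G with is_Cseries ?u ?l => set (v := u) in G; set (m := l) in G end.
match goal with |- is_Cseries _ ?l => replace l with m by (unfold m; simpl; ring) end.
eapply is_Cseries_ext; [|exact G].
intros k. unfold v, Cderiv_coef, op_coef.
replace (denom gam del (S k) / 2) with
  (gam * INR (S k) + del * (INR k * INR (S k))
   + (del - gam) / 2 * ((INR k - 1) * INR k * INR (S k)))
  by (unfold denom; rewrite S_INR; field).
rewrite !RtoC_plus, !(RtoC_mult gam), !(RtoC_mult del), !(RtoC_mult ((del - gam) / 2)). ring.
Qed.

(** * Finite sums and series *)

Lemma sum_n_RS (u : nat -> R) n : @eq R (sum_n u (S n)) (sum_n u n + u (S n)).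
Proof. exact (sum_Sn u n). Qed.

Lemma sum_n_nonneg (u : nat -> R) n : (forall k, (k <= n)%nat -> 0 <= u k) -> 0 <= sum_n u n.
Proof.
induction n as [|n IH]; intros H; [rewrite sum_O; now apply H|].
rewrite sum_n_RS. assert (0 <= sum_n u n) by (apply IH; intros; apply H; lia).
generalize (H (S n) ltac:(lia)); lra.
Qed.

Lemma sum_n_le_Series (u : nat -> R) n :
  (forall k, 0 <= u k) -> ex_series u -> sum_n u n <= Series u.
Proof.
intros H [l Hl]. rewrite (is_series_unique _ _ Hl).
apply (is_lim_seq_incr_compare (sum_n u) l); [exact Hl|].
intros m. rewrite sum_n_RS. generalize (H (S m)); lra.
Qed.

Lemma term_le_Series (u : nat -> R) k :
  (forall k, 0 <= u k) -> ex_series u -> u k <= Series u.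
Proof.
intros H Hu. eapply Rle_trans; [|apply (sum_n_le_Series u k H Hu)].
destruct k as [|k]; [rewrite sum_O; lra|]. rewrite sum_n_RS.
generalize (sum_n_nonneg u k (fun i _ => H i)). lra.
Qed.

Lemma series_tail_lim (u : nat -> R) :
  ex_series u -> is_lim_seq (fun n => Series u - sum_n u n) 0.
Proof.
intros Hu. replace 0 with (Series u - Series u) by ring.
apply is_lim_seq_minus'; [apply is_lim_seq_const|exact (Series_correct _ Hu)].
Qed.

(** A partial sum differs from the whole sum by at most the tail of a
    dominating series: apply [sum_n_le_Series] to [v - u]. *)
Lemma sum_n_ge_Series (u v : nat -> R) n :
  (forall k, Rabs (u k) <= v k) -> ex_series v ->
  Series u - (Series v - sum_n v n) <= sum_n u n.
Proof.
intros H Hv.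
assert (Hu : ex_series u).
{ apply (ex_series_le (V := R_CompleteNormedModule) u v); [exact H|exact Hv]. }
assert (X := sum_n_le_Series (fun k => v k - u k) n).
rewrite Series_minus in X by easy.
assert (E : @eq R (sum_n (fun k => v k - u k) n) (sum_n v n - sum_n u n)).
{ clear X. induction n as [|n IH]; [now rewrite !sum_O|]. rewrite !sum_n_RS, IH. ring. }
rewrite E in X.
assert (ex_series (fun k => v k - u k)) by now apply (ex_series_minus (V := R_NormedModule)).
assert (forall k, 0 <= v k - u k).
{ intros k. generalize (H k) (Rle_abs (u k)); lra. }
specialize (X ltac:(assumption) ltac:(assumption)). lra.
Qed.

Lemma Rabs_sum_n_le (u v : nat -> R) n :
  (forall k, Rabs (u k) <= v k) -> ex_series v -> Rabs (sum_n u n) <= Series v.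
Proof.
intros H Hv. eapply Rle_trans with (sum_n v n).
- clear Hv. induction n as [|n IH]; [rewrite !sum_O; apply H|].
  rewrite !sum_n_RS. eapply Rle_trans; [apply Rabs_triang|].
  generalize (H (S n)); lra.
- apply sum_n_le_Series; [|exact Hv]. intros k. generalize (H k) (Rabs_pos (u k)); lra.
Qed.

Lemma is_series_single (u : nat -> R) m :
  (forall k, k <> m -> u k = 0) -> is_series u (u m).
Proof.
intros H.
assert (E : forall n, @eq R (sum_n u n) (if Nat.leb m n then u m else 0)).
{ induction n as [|n IH].
  - rewrite sum_O. destruct m; [easy|]. simpl. now apply H.
  - rewrite sum_n_RS, IH. destruct (Nat.eq_dec m (S n)) as [->|E].
    + rewrite Nat.leb_refl. replace (Nat.leb (S n) n) with false; [ring|].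
      symmetry. apply Nat.leb_gt. lia.
    + rewrite (H (S n)) by lia.
      destruct (Nat.leb_spec m n); destruct (Nat.leb_spec m (S n)); try lia; ring. }
apply (filterlim_ext_loc (fun _ => u m)).
- exists m. intros n Hn. rewrite E. destruct (Nat.leb_spec m n); [easy|lia].
- apply filterlim_const.
Qed.

Lemma is_Cseries_single (u : nat -> C) m :
  (forall k, k <> m -> u k = RtoC 0) -> is_Cseries u (u m).
Proof.
intros H. apply is_Cseries_iff. split.
- apply (is_series_single (fun k => Re (u k)) m). intros k Hk. now rewrite H.
- apply (is_series_single (fun k => Im (u k)) m). intros k Hk. now rewrite H.
Qed.

Lemma sum_n_CS (u : nat -> C) n : @eq C (sum_n u (S n)) (sum_n u n + u (S n))%C.
Proof. exact (sum_Sn u n). Qed.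

Lemma sum_n_C_scal (c : C) (u : nat -> C) n :
  @eq C (sum_n (fun k => c * u k)%C n) (c * sum_n u n)%C.
Proof. exact (sum_n_mult_l (K := C_Ring) c u n). Qed.

Lemma sum_n_C_conj (u : nat -> C) n :
  @eq C (sum_n (fun k => Cconj (u k)) n) (Cconj (sum_n u n)).
Proof.
induction n as [|n IH]; [now rewrite !sum_O|].
now rewrite !sum_n_CS, IH, Cplus_conj.
Qed.

Lemma sum_n_C_switch (u : nat -> nat -> C) m n :
  sum_n (fun i => sum_n (u i) n) m = sum_n (fun j => sum_n (fun i => u i j) m) n.
Proof. exact (sum_n_switch (G := C_AbelianMonoid) u m n). Qed.

Lemma sum_n_C_zero (u : nat -> C) n :
  (forall k, (k <= n)%nat -> u k = RtoC 0) -> @eq C (sum_n u n) (RtoC 0).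
Proof.
induction n as [|n IH]; intros H; [rewrite sum_O; now apply H|].
rewrite sum_n_CS, IH, H by (intros; try apply H; lia). ring.
Qed.

Lemma sum_n_C_single (u : nat -> C) n i :
  (i <= n)%nat -> (forall k, (k <= n)%nat -> k <> i -> u k = RtoC 0) -> @eq C (sum_n u n) (u i).
Proof.
induction n as [|n IH]; intros Hi H; [rewrite sum_O; f_equal; lia|].
rewrite sum_n_CS. destruct (Nat.eq_dec i (S n)) as [->|E].
- rewrite sum_n_C_zero; [ring|]. intros; apply H; lia.
- rewrite IH, (H (S n)); [ring|lia|lia|lia|]. intros; apply H; lia.
Qed.

Lemma sum_n_C_const (c : C) n : @eq C (sum_n (fun _ => c) n) (RtoC (INR (S n)) * c)%C.
Proof.
induction n as [|n IH]; [rewrite sum_O; simpl; ring|].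
rewrite sum_n_CS, IH, (S_INR (S n)), RtoC_plus. ring.
Qed.

Lemma sum_n_C_geom (q : C) n : ((q - 1) * sum_n (fun k => q ^ k)%C n = q ^ S n - 1)%C.
Proof.
induction n as [|n IH]; [rewrite sum_O; simpl; ring|].
rewrite sum_n_CS, Cmult_plus_distr_l, IH. simpl. ring.
Qed.

(** * Roots of unity and discrete means *)

Definition cis (t : R) : C := (cos t, sin t).

Lemma cis_pow t k : (cis t ^ k)%C = cis (INR k * t).
Proof.
induction k as [|k IH].
- simpl Cpow. unfold cis. rewrite Rmult_0_l, cos_0, sin_0. reflexivity.
- simpl Cpow. rewrite IH, S_INR, Rmult_plus_distr_r, Rmult_1_l.
  unfold cis. rewrite cos_plus, sin_plus. apply C_eq; unfold Re, Im; simpl; ring.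
Qed.

Lemma Cmod_cis t : Cmod (cis t) = 1.
Proof.
unfold Cmod, cis. simpl. transitivity (sqrt 1); [f_equal|apply sqrt_1].
generalize (sin2_cos2 t). unfold Rsqr. lra.
Qed.

Lemma cis_neq_1 t : 0 < t < 2 * PI -> cis t <> RtoC 1.
Proof.
intros Ht E. assert (Ec : cos t = 1) by exact (f_equal Re E).
assert (Hs : 0 < sin (t / 2)) by (apply sin_gt_0; lra).
replace t with (2 * (t / 2)) in Ec by field. rewrite cos_2a_sin in Ec. nra.
Qed.

Definition root_of_unity (M : nat) : C := cis (2 * PI / INR M).

Lemma root_of_unity_sum p m :
  (0 < m <= p)%nat ->
  @eq C (sum_n (fun j => ((root_of_unity (S p) ^ j) ^ m)%C) p) (RtoC 0).
Proof.
intros Hm. set (M := S p). assert (HM : 0 < INR M) by (apply lt_0_INR; lia).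
set (q := (root_of_unity M ^ m)%C).
assert (Hq : q <> RtoC 1).
{ unfold q, root_of_unity. rewrite cis_pow. apply cis_neq_1.
  assert (P := PI_RGT_0). assert (0 < INR m) by (apply lt_0_INR; lia).
  assert (INR m < INR M) by (apply lt_INR; lia).
  replace (INR m * (2 * PI / INR M)) with (2 * PI * (INR m / INR M)) by (field; lra).
  assert (0 < INR m / INR M < 1).
  { split; [now apply Rdiv_lt_0_compat|]. apply Rmult_lt_reg_r with (INR M); [easy|].
    unfold Rdiv. rewrite Rmult_assoc, Rinv_l; lra. }
  nra. }
assert (HqM : (q ^ M = 1)%C).
{ unfold q, root_of_unity. rewrite <- Cpow_mult_r, Nat.mul_comm, Cpow_mult_r.
  rewrite cis_pow. replace (INR M * (2 * PI / INR M)) with (2 * PI) by (field; lra).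
  replace (cis (2 * PI)) with (RtoC 1); [apply Cpow_1_l|].
  unfold cis. now rewrite cos_2PI, sin_2PI. }
assert (G := sum_n_C_geom q p). fold M in G. rewrite HqM in G.
replace (1 - 1)%C with (RtoC 0) in G by ring.
rewrite (sum_n_ext _ (fun k => q ^ k)%C).
2:{ intros j. unfold q. rewrite <- !Cpow_mult_r. f_equal. lia. }
assert (Hq1 : (q - 1)%C <> RtoC 0).
{ intros E. apply Hq. replace q with (q - 1 + 1)%C by ring. rewrite E. ring. }
match type of G with (_ * ?s)%C = _ => set (S := s) in * end.
replace S with (/ (q - 1) * ((q - 1) * S))%C by (field; exact Hq1).
rewrite G. ring.
Qed.

Lemma sum_n_C_ext_loc (u v : nat -> C) n :
  (forall k, (k <= n)%nat -> u k = v k) -> @eq C (sum_n u n) (sum_n v n).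
Proof. exact (sum_n_ext_loc u v n). Qed.

Lemma sum_n_C_ext (u v : nat -> C) n :
  (forall k, u k = v k) -> @eq C (sum_n u n) (sum_n v n).
Proof. intros H; apply sum_n_C_ext_loc; auto. Qed.

Lemma sum_n_R_ext (u v : nat -> R) n :
  (forall k, u k = v k) -> @eq R (sum_n u n) (sum_n v n).
Proof. exact (fun H => sum_n_ext u v n H). Qed.

Lemma sum_n_R_scal (c : R) (u : nat -> R) n :
  @eq R (sum_n (fun k => c * u k) n) (c * sum_n u n).
Proof. exact (sum_n_mult_l (K := R_Ring) c u n). Qed.

Lemma sum_n_R_plus (u v : nat -> R) n :
  @eq R (sum_n (fun k => u k + v k) n) (sum_n u n + sum_n v n).
Proof. exact (sum_n_plus (G := R_AbelianMonoid) u v n). Qed.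

Definition Cpoly (a : nat -> C) (n : nat) (z : C) : C := sum_n (fun k => a k * z ^ k)%C n.

Lemma Cpoly_sum_swap (a : nat -> C) n (z c : nat -> C) m :
  @eq C (sum_n (fun j => Cpoly a n (z j) * c j)%C m)
        (sum_n (fun k => a k * sum_n (fun j => z j ^ k * c j)%C m)%C n).
Proof.
rewrite (sum_n_C_ext _ (fun j => sum_n (fun k => a k * (z j ^ k * c j))%C n)).
- rewrite sum_n_C_switch. apply sum_n_C_ext. intros k. apply sum_n_C_scal.
- intros j. unfold Cpoly. rewrite Cmult_comm, <- sum_n_C_scal.
  apply sum_n_C_ext. intros k. ring.
Qed.

Definition unity_node (n j : nat) : C := (root_of_unity (S (2 * n)) ^ j)%C.

Lemma Cmod_unity_node n j : Cmod (unity_node n j) = 1.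
Proof. unfold unity_node, root_of_unity. now rewrite Cmod_pow, Cmod_cis, pow1. Qed.

Lemma unimodular_conj (w : C) : Cmod w = 1 -> (w * Cconj w = 1)%C.
Proof. intros H. rewrite <- Cmod2_conj, H. simpl. now rewrite !Rmult_1_l. Qed.

(** With [2 n + 1] nodes, frequencies up to [n] stay distinct even after the
    products [w^(k+l)] are formed, so the discrete means of polynomials of degree
    at most [n] are exact. *)
Lemma unity_node_orth n k l :
  (k <= n)%nat -> (l <= n)%nat -> k <> l ->
  @eq C (sum_n (fun j => unity_node n j ^ k * Cconj (unity_node n j ^ l))%C (2 * n))
        (RtoC 0).
Proof.
assert (W : forall k l, (l < k <= n)%nat ->
  @eq C (sum_n (fun j => unity_node n j ^ k * Cconj (unity_node n j ^ l))%C (2 * n))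
        (RtoC 0)).
{ clear. intros k l H.
  rewrite <- (root_of_unity_sum (2 * n) (k - l)) by lia.
  apply sum_n_C_ext. intros j. fold (unity_node n j).
  replace k with (l + (k - l))%nat at 1 by lia.
  rewrite Cpow_add_r.
  transitivity (unity_node n j ^ l * Cconj (unity_node n j ^ l)
                 * unity_node n j ^ (k - l))%C; [ring|].
  rewrite unimodular_conj; [ring|]. now rewrite Cmod_pow, Cmod_unity_node, pow1. }
intros Hk Hl Hkl. destruct (Nat.lt_total k l) as [H|[H|H]]; [|lia|apply W; lia].
rewrite (sum_n_C_ext _ (fun j => Cconj (unity_node n j ^ l * Cconj (unity_node n j ^ k)))).
- rewrite sum_n_C_conj, W by lia. apply Cconj_RtoC.
- intros j. rewrite Cmult_conj, Cconj_conj. ring.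
Qed.

Lemma discrete_mean_conj (a b : nat -> C) n :
  @eq C (sum_n (fun j => Cpoly a n (unity_node n j) * Cconj (Cpoly b n (unity_node n j)))%C
          (2 * n))
        (RtoC (INR (S (2 * n))) * sum_n (fun k => a k * Cconj (b k))%C n)%C.
Proof.
rewrite Cpoly_sum_swap, <- sum_n_C_scal. apply sum_n_C_ext_loc. intros k Hk.
rewrite (sum_n_C_ext _ (fun j => Cconj
   (Cpoly b n (unity_node n j) * Cconj (unity_node n j ^ k)))).
2:{ intros j. rewrite Cmult_conj, Cconj_conj. ring. }
rewrite sum_n_C_conj, Cpoly_sum_swap, (sum_n_C_single _ n k Hk).
- rewrite (sum_n_C_ext _ (fun _ => RtoC 1)).
  + rewrite sum_n_C_const, Cmult_1_r, Cmult_conj.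
    rewrite Cconj_RtoC. ring.
  + intros j. apply unimodular_conj. now rewrite Cmod_pow, Cmod_unity_node, pow1.
- intros l Hl Hlk. rewrite unity_node_orth by auto. ring.
Qed.

Lemma discrete_mean_prod (a b : nat -> C) n :
  @eq C (sum_n (fun j => Cpoly a n (unity_node n j) * Cpoly b n (unity_node n j))%C (2 * n))
        (RtoC (INR (S (2 * n))) * (a O * b O))%C.
Proof.
rewrite Cpoly_sum_swap, (sum_n_C_single _ n 0); [|lia|].
- rewrite (sum_n_C_ext _ (fun j => Cpoly b n (unity_node n j) * 1)%C).
  2:{ intros j. simpl. ring. }
  rewrite Cpoly_sum_swap, (sum_n_C_single _ n 0); [|lia|].
  + rewrite (sum_n_C_ext _ (fun _ => RtoC 1)); [|intros j; simpl; ring].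
    rewrite sum_n_C_const. ring.
  + intros l Hl H0.
    rewrite (sum_n_C_ext _ (fun j => (root_of_unity (S (2 * n)) ^ j) ^ l)%C).
    2:{ intros j. unfold unity_node. ring. }
    rewrite (root_of_unity_sum (2 * n) l) by lia. ring.
- intros k Hk H0.
  rewrite (sum_n_C_ext _ (fun j => Cpoly b n (unity_node n j) * unity_node n j ^ k)%C).
  2:{ intros j. ring. }
  rewrite Cpoly_sum_swap, sum_n_C_zero; [ring|].
  intros l Hl.
  rewrite (sum_n_C_ext _ (fun j => (root_of_unity (S (2 * n)) ^ j) ^ (l + k))%C).
  2:{ intros j. unfold unity_node. now rewrite <- Cpow_add_r. }
  rewrite (root_of_unity_sum (2 * n) (l + k)) by lia. ring.
Qed.

(** From [Re A * Re B = (Re (A B) + Re (A conj B)) / 2]: the first product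
    only retains its constant term, the second is Parseval's identity. *)
Lemma discrete_mean_Re (a b : nat -> C) n :
  @eq R (sum_n (fun j => Re (Cpoly a n (unity_node n j)) * Re (Cpoly b n (unity_node n j)))
           (2 * n))
        (INR (S (2 * n)) / 2 *
          (Re (a O * b O)%C + sum_n (fun k => Re (a k * Cconj (b k))%C) n)).
Proof.
assert (E1 := f_equal Re (discrete_mean_conj a b n)).
assert (E2 := f_equal Re (discrete_mean_prod a b n)).
rewrite Re_sum_n, re_scal_l in E1. rewrite Re_sum_n, re_scal_l in E2.
rewrite Re_sum_n in E1.
set (sa := sum_n (fun k => Re (a k * Cconj (b k))%C) n) in *.
rewrite (sum_n_R_ext _ (fun j =>
   / 2 * Re (Cpoly a n (unity_node n j) * Cconj (Cpoly b n (unity_node n j)))%C +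
   (/ 2 * Re (Cpoly a n (unity_node n j) * Cpoly b n (unity_node n j))%C))).
2:{ intros j. rewrite !re_mult, re_conj, im_conj. field. }
rewrite sum_n_R_plus, !sum_n_R_scal, E1, E2. field.
Qed.

Lemma sum_n_R_ge (u : nat -> R) c n :
  (forall k, c <= u k) -> INR (S n) * c <= sum_n u n.
Proof.
intros H. induction n as [|n IH]; [rewrite sum_O; simpl; generalize (H O); lra|].
rewrite sum_n_RS, (S_INR (S n)). generalize (H (S n)); lra.
Qed.

(** * Pairing of series with non-negative real part *)

(** The right-hand side is twice the mean of [Re A * Re B] over the unit circle,
    where both factors are non-negative. The mean is taken over roots of unity:
    truncating [A] and [B] at degree [n] makes it exact and perturbs the signs
    by at most the tails [ta n] and [tb n], which tend to 0. *)
Lemma positive_pairing (a b : nat -> C) :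
  ex_series (fun k => Cmod (a k)) -> ex_series (fun k => Cmod (b k)) ->
  (forall w, Cmod w = 1 -> 0 <= Re (Cpseries a w)) ->
  (forall w, Cmod w = 1 -> 0 <= Re (Cpseries b w)) ->
  0 <= Re (a O * b O)%C + Series (fun k => Re (a k * Cconj (b k))%C).
Proof.
intros Ha Hb Pa Pb.
set (Sa := Series (fun k => Cmod (a k))). set (Sb := Series (fun k => Cmod (b k))).
set (ta := fun n => Sa - sum_n (fun k => Cmod (a k)) n).
set (tb := fun n => Sb - sum_n (fun k => Cmod (b k)) n).
assert (low : forall (c : nat -> C), ex_series (fun k => Cmod (c k)) ->
   (forall w, Cmod w = 1 -> 0 <= Re (Cpseries c w)) ->
   forall n w, Cmod w = 1 ->
   - (Series (fun k => Cmod (c k)) - sum_n (fun k => Cmod (c k)) n) <= Re (Cpoly c n w)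
   <= Series (fun k => Cmod (c k))).
{ intros c Hc Pc n w Hw. unfold Cpoly. rewrite Re_sum_n.
  assert (Hk : forall k, Rabs (Re (c k * w ^ k)%C) <= Cmod (c k)).
  { intros k. eapply Rle_trans; [apply re_le_Cmod|].
    rewrite Cmod_mult, Cmod_pow, Hw, pow1. lra. }
  assert (P1 := sum_n_ge_Series _ _ n Hk Hc).
  assert (P2 := Rabs_sum_n_le _ _ n Hk Hc).
  assert (P3 : 0 <= Series (fun k => Re (c k * w ^ k)%C)) by exact (Pc w Hw).
  set (q := sum_n (fun k => Re (c k * w ^ k)%C) n) in *.
  assert (P4 := Rle_abs q). split; lra. }
assert (X : forall n, - (2 * (ta n * Sb + tb n * Sa + ta n * tb n))
   <= Re (a O * b O)%C + sum_n (fun k => Re (a k * Cconj (b k))%C) n).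
{ intros n. assert (E := discrete_mean_Re a b n).
  assert (Q : INR (S (2 * n)) * - (ta n * Sb + tb n * Sa + ta n * tb n)
    <= sum_n (fun j => Re (Cpoly a n (unity_node n j)) * Re (Cpoly b n (unity_node n j)))
           (2 * n)).
  { apply sum_n_R_ge. intros j.
    destruct (low a Ha Pa n _ (Cmod_unity_node n j)) as [A1 A2].
    destruct (low b Hb Pb n _ (Cmod_unity_node n j)) as [B1 B2].
    assert (T1 : 0 <= ta n).
    { unfold ta, Sa. generalize (sum_n_le_Series (fun k => Cmod (a k)) n
        (fun k => Cmod_ge_0 _) Ha). lra. }
    assert (T2 : 0 <= tb n).
    { unfold tb, Sb. generalize (sum_n_le_Series (fun k => Cmod (b k)) n
        (fun k => Cmod_ge_0 _) Hb). lra. }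
    (* Expand (Re A + ta) (Re B + tb) >= 0 and bound Re A and Re B by Sa and Sb. *)
    fold Sa in A1, A2. fold Sb in B1, B2. fold (ta n) in A1. fold (tb n) in B1.
    nra. }
  rewrite E in Q.
  assert (0 < INR (S (2 * n))) by (apply lt_0_INR; lia).
  nra. }
assert (Hs : ex_series (fun k => Re (a k * Cconj (b k))%C)).
{ apply (ex_series_le (V := R_CompleteNormedModule)) with (fun k => Sb * Cmod (a k)).
  - intros k. eapply Rle_trans; [apply re_le_Cmod|].
    rewrite Cmod_mult, Cmod_conj, Rmult_comm.
    apply Rmult_le_compat_r; [apply Cmod_ge_0|].
    apply (term_le_Series (fun k => Cmod (b k)) k (fun k => Cmod_ge_0 _) Hb).
  - now apply ex_series_mult_l. }
assert (La : is_lim_seq ta 0) by exact (series_tail_lim _ Ha).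
assert (Lb : is_lim_seq tb 0) by exact (series_tail_lim _ Hb).
apply (is_lim_seq_le _ _ 0 (Re (a O * b O)%C + Series (fun k => Re (a k * Cconj (b k))%C)) X).
- evar_last.
  + apply (proj1 (is_lim_seq_opp _ (2 * (0 * Sb + 0 * Sa + 0 * 0)))).
    apply (is_lim_seq_mult' (fun _ => 2) _ 2 _ (is_lim_seq_const 2)).
    apply is_lim_seq_plus'; [apply is_lim_seq_plus'|apply is_lim_seq_mult'; assumption].
    * exact (is_lim_seq_mult' _ _ _ _ La (is_lim_seq_const Sb)).
    * exact (is_lim_seq_mult' _ _ _ _ Lb (is_lim_seq_const Sa)).
  + simpl. f_equal. ring.
- apply is_lim_seq_plus'; [apply is_lim_seq_const|]. exact (Series_correct _ Hs).
Qed.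

(** * Multipliers that preserve non-negativity *)

Lemma is_series_R_ext (u v : nat -> R) l :
  (forall k, u k = v k) -> is_series u l -> is_series v l.
Proof. exact (is_series_ext u v l). Qed.

Definition bounded (d : nat -> R) : Prop := exists M, forall k, Rabs (d k) <= M.

Lemma bounded_CV_radius d x : bounded d -> Rabs x < 1 -> Rbar_lt (Rabs x) (CV_radius d).
Proof.
intros [M HM] Hx. apply Rbar_lt_le_trans with 1; [exact Hx|].
apply (CV_radius_bounded d). exists M. intros k. rewrite pow1, Rmult_1_r. apply HM.
Qed.

(** The factor [al + be k] on coefficients is the operator [al + be s d/ds]. *)
Lemma PSeries_euler_op (d : nat -> R) al be s :
  bounded d -> Rabs s < 1 ->
  PSeries (fun k => (al + be * INR k) * d k) s
  = al * PSeries d s + be * (s * PSeries (PS_derive d) s).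
Proof.
intros Hd Hs. assert (Hr := bounded_CV_radius d s Hd Hs).
assert (Hr' : Rbar_lt (Rabs s) (CV_radius (PS_derive d))) by now rewrite CV_radius_derive.
assert (Hr2 : Rbar_lt (Rabs s) (CV_radius (PS_incr_1 (PS_derive d))))
  by now rewrite CV_radius_incr_1.
rewrite <- (PSeries_incr_1 (PS_derive d)).
rewrite <- !PSeries_scal, <- PSeries_plus.
- apply PSeries_ext. intros [|k]; unfold PS_plus, PS_scal, PS_incr_1, PS_derive.
  + simpl. unfold plus, scal, zero. simpl. unfold mult. simpl. ring.
  + unfold plus, scal. simpl. unfold mult. simpl. ring.
- apply ex_pseries_scal; [apply Rmult_comm|now apply CV_radius_inside].
- apply ex_pseries_scal; [apply Rmult_comm|now apply CV_radius_inside].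
Qed.

(** At a point [m] where [D] attains a negative minimum over [[0, s0]],
    [al D + be m D' >= 0] forces [m > 0] and [D' m > 0], so [D] would take smaller
    values just to the left of [m]. *)
Lemma nonneg_of_euler_op (d : nat -> R) al be s0 :
  0 < al -> 0 <= be -> 0 <= s0 < 1 -> bounded d ->
  (forall s, 0 <= s <= s0 -> 0 <= PSeries (fun k => (al + be * INR k) * d k) s) ->
  forall s, 0 <= s <= s0 -> 0 <= PSeries d s.
Proof.
intros Hal Hbe Hs0 Hd H s Hs.
destruct (continuity_ab_min (PSeries d) 0 s0) as [m [Hmin Hm]]; [lra| |].
{ intros c Hc. apply PSeries_continuity, bounded_CV_radius; [easy|].
  rewrite Rabs_pos_eq; lra. }
assert (Hms := Hmin s Hs).
destruct (Rle_or_lt 0 (PSeries d m)) as [P|P]; [lra|exfalso].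
assert (Hm1 : Rabs m < 1) by (rewrite Rabs_pos_eq; lra).
assert (Hpos := H m Hm). rewrite PSeries_euler_op in Hpos by easy.
set (D := PSeries (PS_derive d) m) in *.
assert (HD : 0 < be * (m * D)) by nra.
assert (Hm0 : 0 < m).
{ destruct (Req_dec m 0) as [E|E]; [rewrite E in HD; lra|lra]. }
assert (HDp : 0 < D).
{ destruct (Rlt_or_le 0 D) as [Q|Q]; [exact Q|exfalso].
  assert (be * m * D <= 0); [|lra].
  assert (0 <= be * m) by nra. nra. }
assert (Hder := is_derive_PSeries d m (bounded_CV_radius d m Hd Hm1)).
apply is_derive_Reals in Hder. fold D in Hder.
destruct (Hder (D / 2) ltac:(lra)) as [eta He].
set (h := - Rmin (eta / 2) (m / 2)).
assert (Heta := cond_pos eta).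
assert (Hh : 0 < - h /\ - h <= eta / 2 /\ - h <= m / 2).
{ unfold h. rewrite Ropp_involutive. repeat split.
  - apply Rmin_pos; lra.
  - apply Rmin_l.
  - apply Rmin_r. }
assert (Q := He h ltac:(lra) ltac:(rewrite Rabs_left; lra)).
assert (Qm := Hmin (m + h) ltac:(lra)).
apply Rabs_def2 in Q. destruct Q as [_ Q].
assert ((PSeries d (m + h) - PSeries d m) / h <= 0).
{ unfold Rdiv. assert (/ h < 0) by (apply Rinv_lt_0_compat; lra). nra. }
lra.
Qed.

(** The segment is kept closed and variable so that the notion covers both
    bounds valid on all of [[0, 1)] and bounds valid only up to [s0]; boundedness
    is carried along so that multipliers compose. *)
Definition positive_multiplier (mu : nat -> R) : Prop :=
  forall (d : nat -> R) s0, 0 <= s0 < 1 -> bounded d ->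
  (forall s, 0 <= s <= s0 -> 0 <= PSeries d s) ->
  bounded (fun k => mu k * d k) /\
  forall s, 0 <= s <= s0 -> 0 <= PSeries (fun k => mu k * d k) s.

Lemma positive_multiplier_inv_linear al be :
  0 < al -> 0 <= be -> positive_multiplier (fun k => / (al + be * INR k)).
Proof.
intros Hal Hbe d s0 Hs0 [M HM] H.
assert (Hk : forall k, al <= al + be * INR k).
{ intros k. generalize (Rmult_le_pos _ _ Hbe (pos_INR k)). lra. }
assert (B : bounded (fun k => / (al + be * INR k) * d k)).
{ exists (/ al * M). intros k. specialize (Hk k). rewrite Rabs_mult.
  apply Rmult_le_compat; try apply Rabs_pos; [|apply HM].
  rewrite Rabs_pos_eq; [|apply Rlt_le, Rinv_0_lt_compat; lra].
  apply Rinv_le_contravar; lra. }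
split; [exact B|].
apply nonneg_of_euler_op with al be; [easy|easy|easy|exact B|].
intros s Hs. rewrite (PSeries_ext _ d); [now apply H|].
intros k. specialize (Hk k). field. lra.
Qed.

Lemma positive_multiplier_mult mu nu :
  positive_multiplier mu -> positive_multiplier nu ->
  positive_multiplier (fun k => mu k * nu k).
Proof.
intros Hm Hn d s0 Hs0 Hd H.
destruct (Hn d s0 Hs0 Hd H) as [B1 P1].
destruct (Hm _ s0 Hs0 B1 P1) as [[M HM] P2]. split.
- exists M. intros k. rewrite Rmult_assoc. apply HM.
- intros s Hs. rewrite (PSeries_ext _ (fun k => mu k * (nu k * d k))).
  + now apply P2.
  + intros k; ring.
Qed.

Lemma positive_multiplier_ext mu nu :
  (forall k, mu k = nu k) -> positive_multiplier mu -> positive_multiplier nu.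
Proof.
intros E H d s0 Hs0 Hd P. destruct (H d s0 Hs0 Hd P) as [[M B] Q]. split.
- exists M. intros k. rewrite <- E. apply B.
- intros s Hs. rewrite (PSeries_ext _ (fun k => mu k * d k)).
  + now apply Q.
  + intros k; now rewrite E.
Qed.

(** * The Poisson kernel *)

Definition poisson_coef (k : nat) : R := match k with O => 1 | S _ => 2 end.

Lemma one_minus_neq_0 z : Cmod z < 1 -> (1 - z)%C <> RtoC 0.
Proof.
intros Hz E. replace z with (1 - (1 - z))%C in Hz by ring. rewrite E in Hz.
replace (1 - 0)%C with (RtoC 1) in Hz by ring. rewrite Cmod_1 in Hz. lra.
Qed.

Lemma is_Cseries_geom z : Cmod z < 1 -> is_Cseries (fun k => z ^ k)%C (/ (1 - z))%C.
Proof.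
intros Hz.
assert (Hn := one_minus_neq_0 z Hz).
assert (He : ex_series (fun k => Cmod (z ^ k)%C)).
{ apply ex_series_ext with (fun k => Cmod z ^ k); [intros k; now rewrite Cmod_pow|].
  apply ex_series_geom. rewrite Rabs_pos_eq; [exact Hz|apply Cmod_ge_0]. }
assert (H := is_Cseries_abs _ He). set (S := Cseries (fun k => z ^ k)%C) in *.
assert (E1 := is_Cseries_unique _ _ (is_Cseries_decr _ _ H)).
assert (E2 := is_Cseries_unique _ _ (is_Cseries_scal z _ _ H)).
assert (E : (S - 1 = z * S)%C) by (rewrite <- E2; symmetry; exact E1).
replace (/ (1 - z))%C with S; [exact H|].
assert (E3 : ((1 - z) * S = 1)%C).
{ transitivity (S - z * S)%C; [ring|]. rewrite <- E. ring. }
transitivity (/ (1 - z) * ((1 - z) * S))%C; [field; exact Hn|].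
rewrite E3. ring.
Qed.

Lemma is_Cseries_poisson z :
  Cmod z < 1 ->
  is_Cseries (fun k => RtoC (poisson_coef k) * z ^ k)%C ((1 + z) / (1 - z))%C.
Proof.
intros Hz. assert (H := is_Cseries_geom z Hz).
assert (Hn := one_minus_neq_0 z Hz).
apply (is_series_decr_1 (V := C_NormedModule)).
change (is_Cseries (fun k => RtoC 2 * z ^ S k)%C
          ((1 + z) / (1 - z) + - (RtoC 1 * z ^ 0))%C).
replace ((1 + z) / (1 - z) + - (RtoC 1 * z ^ 0))%C with ((2 * z) * / (1 - z))%C.
- eapply is_Cseries_ext; [|apply (is_Cseries_scal (2 * z)), H].
  intros k. cbn beta. simpl Cpow. ring.
- simpl Cpow. field. exact Hn.
Qed.

(** [Re ((1+z)/(1-z)) = (1-|z|^2) / |1-z|^2], and [|1-z| <= 1+|z|]. *)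
Lemma poisson_Re_bound z :
  Cmod z < 1 -> (1 - Cmod z) / (1 + Cmod z) <= Re ((1 + z) / (1 - z))%C.
Proof.
intros Hz. set (P := ((1 + z) / (1 - z))%C).
assert (H0 := Cmod_ge_0 z).
assert (Hn := one_minus_neq_0 z Hz).
assert (E : (P * ((1 - z) * Cconj (1 - z)) = (1 + z) * Cconj (1 - z))%C)
  by (unfold P; field; exact Hn).
rewrite <- Cmod2_conj in E. apply (f_equal Re) in E.
rewrite re_scal_r in E.
assert (E' : Re ((1 + z) * Cconj (1 - z))%C = 1 - Cmod z ^ 2).
{ rewrite Cmod2_alt. destruct z as [x y]. unfold Re, Im. simpl. ring. }
rewrite E' in E.
assert (U : Cmod (1 - z)%C <= 1 + Cmod z).
{ eapply Rle_trans; [apply Cmod_triangle|]. rewrite Cmod_opp, Cmod_1. lra. }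
assert (V : 0 < Cmod (1 - z)%C) by now apply Cmod_gt_0.
set (m := Cmod (1 - z)%C) in *. set (r := Cmod z) in *.
assert (HP : 0 <= Re P).
{ destruct (Rle_or_lt 0 (Re P)) as [Q|Q]; [exact Q|exfalso].
  assert (0 < m ^ 2) by nra. nra. }
apply Rmult_le_reg_r with ((1 + r) ^ 2); [nra|].
replace ((1 - r) / (1 + r) * (1 + r) ^ 2) with (1 - r ^ 2) by (field; lra).
rewrite <- E. apply Rmult_le_compat_l; [exact HP|]. apply pow_incr. lra.
Qed.

Lemma poisson_PSeries w s :
  Cmod w = 1 -> 0 <= s < 1 ->
  is_series (fun k => poisson_coef k * Re (w ^ k)%C * s ^ k)
            (Re ((1 + s * w) / (1 - s * w))%C).
Proof.
intros Hw Hs.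
assert (Hz : Cmod (s * w)%C < 1) by (rewrite Cmod_mult, Cmod_R, Hw, Rabs_pos_eq; lra).
eapply is_series_R_ext; [|apply (is_Cseries_Re _ _ (is_Cseries_poisson _ Hz))].
intros k. cbn beta. rewrite re_scal_l, Cpow_mult_l, <- RtoC_pow, re_scal_l. ring.
Qed.

Lemma poisson_bounded w : Cmod w = 1 -> forall k, Rabs (poisson_coef k * Re (w ^ k)%C) <= 2.
Proof.
intros Hw k. rewrite Rabs_mult.
assert (Rabs (Re (w ^ k)%C) <= 1).
{ eapply Rle_trans; [apply re_le_Cmod|]. rewrite Cmod_pow, Hw, pow1. lra. }
assert (0 <= poisson_coef k <= 2) by (destruct k; simpl; lra).
rewrite (Rabs_pos_eq (poisson_coef k)) by lra.
generalize (Rabs_pos (Re (w ^ k)%C)). nra.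
Qed.

(** Abel's theorem under absolute convergence: up to the tails the claim is the
    continuity of a polynomial at 1. *)
Lemma PSeries_radial_limit (d : nat -> R) :
  ex_series (fun k => Rabs (d k)) ->
  forall eps, 0 < eps -> exists eta, 0 <= eta < 1 /\
    forall s, eta < s < 1 -> Rabs (PSeries d s - Series d) < eps.
Proof.
intros Hd eps He.
set (tail := fun n => Series (fun k => Rabs (d k)) - sum_n (fun k => Rabs (d k)) n).
assert (Lt : is_lim_seq tail 0) by exact (series_tail_lim _ Hd).
apply is_lim_seq_spec in Lt.
destruct (Lt (mkposreal (eps / 4) ltac:(lra))) as [n Hn]. simpl in Hn.
specialize (Hn n (Nat.le_refl n)). rewrite Rminus_0_r in Hn.
assert (Htail : forall s, 0 <= s <= 1 ->
   Rabs (PSeries d s - sum_n (fun k => d k * s ^ k) n) < eps / 4).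
{ intros s Hs.
  assert (Hk : forall k, Rabs (d k * s ^ k) <= Rabs (d k)).
  { intros k. rewrite Rabs_mult, <- RPow_abs, (Rabs_pos_eq s) by lra.
    assert (s ^ k <= 1) by (rewrite <- (pow1 k); apply pow_incr; lra).
    assert (0 <= s ^ k) by (apply pow_le; lra). generalize (Rabs_pos (d k)). nra. }
  assert (X1 := sum_n_ge_Series _ _ n Hk Hd).
  assert (Hk' : forall k, Rabs (- (d k * s ^ k)) <= Rabs (d k))
    by (intros k; rewrite Rabs_Ropp; apply Hk).
  assert (X2 := sum_n_ge_Series _ _ n Hk' Hd).
  rewrite Series_opp in X2.
  assert (E : @eq R (sum_n (fun k => - (d k * s ^ k)) n) (- sum_n (fun k => d k * s ^ k) n)).
  { rewrite <- Rmult_1_l, Ropp_mult_distr_r_reverse, Ropp_mult_distr_l, <- sum_n_R_scal.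
    apply sum_n_R_ext. intros k; ring. }
  rewrite E in X2. unfold PSeries. fold (tail n) in X1, X2.
  apply Rabs_def2 in Hn. apply Rabs_def1; lra. }
assert (Hc : continuous (fun s => sum_n (fun k => d k * s ^ k) n : R) 1).
{ clear. induction n as [|n IH].
  - apply continuous_ext with (fun _ => d O).
    + intros x. rewrite sum_O. simpl. ring.
    + apply continuous_const.
  - apply continuous_ext with (fun s => plus (sum_n (fun k => d k * s ^ k) n) (d (S n) * s ^ S n)).
    + intros x. now rewrite sum_Sn.
    + apply (continuous_plus (V := R_NormedModule)); [exact IH|].
      apply (ex_derive_continuous (V := R_NormedModule)). auto_derive. easy. }
apply continuity_pt_filterlim in Hc.
destruct (Hc (eps / 4) ltac:(lra)) as [del [Hdel Hc']].
exists (Rmax 0 (1 - del)). split.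
{ split; [apply Rmax_l|]. apply Rmax_lub_lt; lra. }
intros s Hs.
assert (Hs1 : 0 < s) by (eapply Rle_lt_trans; [apply Rmax_l|apply Hs]).
assert (Hs2 : 1 - del < s) by (eapply Rle_lt_trans; [apply Rmax_r|apply Hs]).
assert (Hp := Hc' s). unfold dist in Hp. simpl in Hp. unfold R_dist in Hp.
assert (Hp' : Rabs (sum_n (fun k => d k * s ^ k) n - sum_n (fun k => d k * 1 ^ k) n) < eps / 4).
{ apply Hp. split; [split; [exact I|lra]|]. rewrite Rabs_left; lra. }
assert (T1 := Htail s ltac:(lra)). assert (T2 := Htail 1 ltac:(lra)).
replace (PSeries d 1) with (Series d) in T2.
2:{ unfold PSeries. apply Series_ext. intros k. rewrite pow1. ring. }
apply Rabs_def2 in T1. apply Rabs_def2 in T2. apply Rabs_def2 in Hp'.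
apply Rabs_def1; lra.
Qed.

(** * Bounds for functions with positive real part *)

(** [positive_pairing] for the dilated series [P_k z^k] and a kernel with real
    constant term [t0]; the constant terms occur twice in the pairing, hence the
    factor 2. *)
Lemma positive_pairing_disk (P : nat -> C) (t0 : R) (t : nat -> C) z :
  disk_summable P -> (forall y, Cmod y < 1 -> 0 <= Re (Cpseries P y)) -> Cmod z < 1 ->
  ex_series (fun k => Cmod (t k)) ->
  (forall w, Cmod w = 1 -> 0 <= t0 + Series (fun k => Re (t k * w ^ S k)%C)) ->
  0 <= 2 * t0 * Re (P O) + Series (fun k => Re (P (S k) * z ^ S k * Cconj (t k))%C).
Proof.
intros HP Pos Hz Ht Ppos.
set (a := fun k => (P k * z ^ k)%C).
set (b := fun k => match k with O => RtoC t0 | S j => t j end).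
assert (Ha : ex_series (fun k => Cmod (a k))) by now apply disk_summable_at.
assert (Hb : ex_series (fun k => Cmod (b k))).
{ apply ex_series_incr_1. exact Ht. }
assert (Hs : forall c : nat -> C, (forall k, Cmod (c k) <= 1) ->
   ex_series (fun k => Re (b k * c k)%C)).
{ intros c Hc. apply (ex_series_le (V := R_CompleteNormedModule)) with (2 := Hb).
  intros k. eapply Rle_trans; [apply re_le_Cmod|]. rewrite Cmod_mult.
  generalize (Hc k) (Cmod_ge_0 (b k)). nra. }
assert (X := positive_pairing a b Ha Hb).
assert (X1 : forall w, Cmod w = 1 -> 0 <= Re (Cpseries a w)).
{ intros w Hw. replace (Cpseries a w) with (Cpseries P (z * w)%C).
  - apply Pos. rewrite Cmod_mult, Hw. lra.
  - apply Cseries_ext. intros k. unfold a. rewrite Cpow_mult_l. ring. }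
assert (X2 : forall w, Cmod w = 1 -> 0 <= Re (Cpseries b w)).
{ intros w Hw. change (0 <= Series (fun k => Re (b k * w ^ k)%C)).
  rewrite Series_incr_1.
  - simpl b. rewrite re_scal_l. change (w ^ 0)%C with (RtoC 1). rewrite re_RtoC, Rmult_1_r.
    now apply Ppos.
  - apply Hs. intros k. rewrite Cmod_pow, Hw, pow1. lra. }
specialize (X X1 X2).
rewrite Series_incr_1 in X.
- unfold a, b in X. change (z ^ 0)%C with (RtoC 1) in X. rewrite Cmult_1_r in X.
  rewrite Cconj_RtoC, re_scal_r in X. lra.
- apply (ex_series_le (V := R_CompleteNormedModule)) with
    (fun k => Series (fun k => Cmod (b k)) * Cmod (a k)).
  + intros k. eapply Rle_trans; [apply re_le_Cmod|]. rewrite Cmod_mult, Cmod_conj, Rmult_comm.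
    apply Rmult_le_compat_r; [apply Cmod_ge_0|].
    apply (term_le_Series (fun k => Cmod (b k)) k (fun k => Cmod_ge_0 _) Hb).
  + now apply ex_series_mult_l.
Qed.

(** Pair with [1 + u w^(k+1)], where [u] is unimodular and [conj u] turns [P_(k+1)]
    onto the negative axis, at radius [r], and let [r] tend to 1. *)
Lemma caratheodory_bound (P : nat -> C) k :
  disk_summable P -> (forall y, Cmod y < 1 -> 0 <= Re (Cpseries P y)) ->
  Cmod (P (S k)) <= 2 * Re (P O).
Proof.
intros HP Pos.
destruct (unimodular_phase (P (S k))) as [c [Hc Ec]].
set (t := fun j => if Nat.eqb j k then (- Cconj c)%C else RtoC 0).
assert (tk : t k = (- Cconj c)%C) by (unfold t; now rewrite Nat.eqb_refl).
assert (tj : forall j, j <> k -> t j = RtoC 0).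
{ intros j Hj. unfold t. apply Nat.eqb_neq in Hj. now rewrite Hj. }
assert (Ht : ex_series (fun j => Cmod (t j))).
{ eexists. apply (is_series_single _ k). intros j Hj. now rewrite tj, Cmod_0. }
assert (H1 : forall w, Cmod w = 1 -> 0 <= 1 + Series (fun j => Re (t j * w ^ S j)%C)).
{ intros w Hw. rewrite (is_series_unique _ (Re (t k * w ^ S k)%C)).
  - assert (X := re_le_Cmod (t k * w ^ S k)%C).
    rewrite tk, Cmod_mult, Cmod_opp, Cmod_conj, Hc, Cmod_pow, Hw, pow1 in X.
    rewrite tk. generalize (Rcomplements.Rabs_le_between (Re (- Cconj c * w ^ S k)%C) 1).
    intros [Y _]. specialize (Y ltac:(lra)). lra.
  - apply (is_series_single (fun j => Re (t j * w ^ S j)%C)).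
    intros j Hj. rewrite (tj j Hj), re_scal_l. ring. }
assert (H2 : forall r, 0 < r < 1 -> Cmod (P (S k)) * r ^ S k <= 2 * Re (P O)).
{ intros r Hr.
  assert (Hrc : Cmod r < 1) by (rewrite Cmod_R, Rabs_pos_eq; lra).
  assert (X := positive_pairing_disk P 1 t r HP Pos Hrc Ht H1).
  rewrite (is_series_unique _ (Re (P (S k) * r ^ S k * Cconj (t k))%C)) in X.
  - rewrite tk in X.
    replace (P (S k) * r ^ S k * Cconj (- Cconj c))%C
      with (RtoC (- r ^ S k) * (c * P (S k)))%C in X.
    + rewrite Ec, re_scal_l, re_RtoC in X. lra.
    + rewrite Copp_conj, Cconj_conj, RtoC_opp, RtoC_pow. ring.
  - apply (is_series_single (fun j => Re (P (S j) * r ^ S j * Cconj (t j))%C)).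
    intros j Hj. rewrite (tj j Hj), Cconj_RtoC, re_scal_r. ring. }
destruct (Rle_or_lt (Cmod (P (S k))) (2 * Re (P O))) as [L|L]; [exact L|exfalso].
assert (Hcont : continuous (fun r => Cmod (P (S k)) * r ^ S k : R) 1).
{ apply (ex_derive_continuous (V := R_NormedModule)). auto_derive. easy. }
apply continuity_pt_filterlim in Hcont.
destruct (Hcont ((Cmod (P (S k)) - 2 * Re (P O)))) as [del [Hdel Hd]]; [lra|].
set (r := 1 - Rmin (del / 2) (/ 2)).
assert (Hr : 0 < 1 - r /\ 1 - r <= del / 2 /\ 1 - r <= / 2).
{ unfold r. replace (1 - (1 - Rmin (del / 2) (/ 2))) with (Rmin (del / 2) (/ 2)) by ring.
  repeat split; [apply Rmin_pos; lra|apply Rmin_l|apply Rmin_r]. }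
assert (Hp := Hd r). simpl in Hp. unfold R_dist in Hp.
assert (Hp' : Rabs (Cmod (P (S k)) * r ^ S k - Cmod (P (S k)) * 1 ^ S k)
   < Cmod (P (S k)) - 2 * Re (P O)).
{ apply Hp. split; [split; [exact I|lra]|]. rewrite Rabs_left; lra. }
rewrite pow1 in Hp'. apply Rabs_def2 in Hp'. specialize (H2 r ltac:(lra)). lra.
Qed.

(** On each ray the Poisson kernel is at least its value [(1-s)/(1+s)] at the
    point [w = -1]. The multiplier preserves the inequality between the
    two kernels for [s < 1], and summability of [mu] lets [s] tend to 1. *)
Lemma kernel_lower_endpoint (mu : nat -> R) w :
  positive_multiplier mu -> ex_series (fun k => Rabs (mu k)) -> Cmod w = 1 ->
  0 <= - (2 * Series (fun k => (-1) ^ S k * mu (S k)))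
       + Series (fun k => Re (RtoC (2 * mu (S k)) * w ^ S k)%C).
Proof.
intros Hmu Hs Hw.
set (d := fun k => poisson_coef k * Re (w ^ k)%C - poisson_coef k * (-1) ^ k).
assert (Hm1 : Cmod (RtoC (-1)) = 1) by (rewrite Cmod_R, Rabs_left; lra).
assert (B : bounded d).
{ exists 4. intros k. unfold d.
  assert (B1 := poisson_bounded w Hw k). assert (B2 := poisson_bounded _ Hm1 k).
  rewrite <- RtoC_pow, re_RtoC in B2.
  eapply Rle_trans; [apply Rabs_triang|]. rewrite Rabs_Ropp. lra. }
assert (Hd : forall s, 0 <= s < 1 -> 0 <= PSeries d s).
{ intros s Hs'.
  assert (S1 := poisson_PSeries w s Hw Hs'). assert (S2 := poisson_PSeries _ s Hm1 Hs').
  assert (S3 := is_series_minus _ _ _ _ S1 S2).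
  assert (E : PSeries d s = Re ((1 + s * w) / (1 - s * w))%C
     - Re ((1 + s * RtoC (-1)) / (1 - s * RtoC (-1)))%C).
  { apply is_series_unique. eapply is_series_R_ext; [|exact S3].
    intros k. unfold d. rewrite <- RtoC_pow, re_RtoC.
    unfold minus, plus, opp; simpl. ring. }
  rewrite E.
  assert (Hz : Cmod (s * w)%C = s) by (rewrite Cmod_mult, Cmod_R, Hw, Rabs_pos_eq; lra).
  assert (Q := poisson_Re_bound (s * w)%C ltac:(lra)). rewrite Hz in Q.
  replace ((1 + s * RtoC (-1)) / (1 - s * RtoC (-1)))%C with (RtoC ((1 - s) / (1 + s))).
  { rewrite re_RtoC. lra. }
  rewrite RtoC_div by lra. rewrite RtoC_minus, RtoC_plus.
  replace (RtoC (-1)) with (- RtoC 1)%C by now rewrite <- RtoC_opp.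
  field. intros F. apply (f_equal Re) in F. unfold Re in F. simpl in F. lra. }
assert (Hmd : forall s, 0 <= s < 1 -> 0 <= PSeries (fun k => mu k * d k) s).
{ intros s Hs'. destruct (Hmu d s Hs' B) as [_ Q]; [|apply Q; lra].
  intros s' Hs''. apply Hd. lra. }
destruct B as [M HM].
assert (Hsum : ex_series (fun k => Rabs (mu k * d k))).
{ apply ex_series_nonneg_le with (fun k => M * Rabs (mu k)).
  - intros k. split; [apply Rabs_pos|]. rewrite Rabs_mult, Rmult_comm.
    apply Rmult_le_compat_r; [apply Rabs_pos|apply HM].
  - now apply ex_series_mult_l. }
assert (Hlim : 0 <= Series (fun k => mu k * d k)).
{ destruct (Rle_or_lt 0 (Series (fun k => mu k * d k))) as [L|L]; [exact L|exfalso].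
  destruct (PSeries_radial_limit _ Hsum (- Series (fun k => mu k * d k)) ltac:(lra))
    as [eta [He Hr]].
  specialize (Hr ((1 + eta) / 2) ltac:(lra)).
  specialize (Hmd ((1 + eta) / 2) ltac:(lra)). apply Rabs_def2 in Hr. lra. }
rewrite Series_incr_1 in Hlim by now apply ex_series_Rabs.
replace (d O) with 0 in Hlim.
2:{ unfold d. simpl. unfold Re. simpl. ring. }
assert (Hmu1 : ex_series (fun k => Rabs (mu (S k)))) by now apply (ex_series_incr_1 (fun k => Rabs (mu k))).
assert (E : Series (fun k => mu (S k) * d (S k)) =
   Series (fun k => Re (RtoC (2 * mu (S k)) * w ^ S k)%C)
   - 2 * Series (fun k => (-1) ^ S k * mu (S k))).
{ rewrite <- Series_scal_l, <- Series_minus.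
  - apply Series_ext. intros k. unfold d. rewrite re_scal_l. simpl poisson_coef. ring.
  - apply (ex_series_le (V := R_CompleteNormedModule)) with (fun k => 2 * Rabs (mu (S k))).
    + intros k. eapply Rle_trans; [apply re_le_Cmod|].
      rewrite Cmod_mult, Cmod_pow, Hw, pow1, Cmod_R, Rabs_mult, (Rabs_pos_eq 2); lra.
    + now apply ex_series_mult_l.
  - apply ex_series_mult_l.
    apply (ex_series_le (V := R_CompleteNormedModule)) with (fun k => Rabs (mu (S k))); [|easy].
    intros k. change (Rabs ((-1) ^ S k * mu (S k)) <= Rabs (mu (S k))).
    rewrite Rabs_mult, <- RPow_abs, (Rabs_left (-1)) by lra.
    replace (- -1) with 1 by ring. rewrite pow1. lra. }
lra.
Qed.

(** Since the kernel is used at [s = 1], the bound is independent of [z] in the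
    disk. *)
Lemma multiplied_series_endpoint (P : nat -> C) (mu : nat -> R) z :
  disk_summable P -> (forall y, Cmod y < 1 -> 0 <= Re (Cpseries P y)) -> Cmod z < 1 ->
  positive_multiplier mu -> ex_series (fun k => Rabs (mu k)) ->
  4 * Re (P O) * Series (fun k => (-1) ^ S k * mu (S k))
    <= Series (fun k => 2 * mu (S k) * Re (P (S k) * z ^ S k)%C).
Proof.
intros HP Pos Hz Hmu Hs.
assert (Ht : ex_series (fun k => Cmod (RtoC (2 * mu (S k))))).
{ apply ex_series_ext with (fun k => 2 * Rabs (mu (S k))).
  - intros k. now rewrite Cmod_R, Rabs_mult, (Rabs_pos_eq 2) by lra.
  - apply ex_series_mult_l. now apply (ex_series_incr_1 (fun k => Rabs (mu k))). }
assert (X := positive_pairing_disk P _ _ z HP Pos Hz Ht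
   (fun w Hw => kernel_lower_endpoint mu w Hmu Hs Hw)).
cbv beta in X. rewrite (Series_ext (fun k => Re (P (S k) * z ^ S k * Cconj (RtoC (2 * mu (S k))))%C)
  (fun k => 2 * mu (S k) * Re (P (S k) * z ^ S k)%C)) in X.
- lra.
- intros k. rewrite <- re_scal_l, Cconj_RtoC. f_equal. ring.
Qed.

(** For a multiplier that is merely bounded the kernel is used at a radius
    [s0 < 1], where comparison with the constant [(1-s0)/(1+s0)], a lower bound of
    the Poisson kernel on [[0, s0]], already gives strict positivity. *)
Lemma kernel_lower_interior (mu : nat -> R) w s0 :
  positive_multiplier mu -> bounded mu -> Cmod w = 1 -> 0 <= s0 < 1 ->
  0 <= mu O * (1 - (1 - s0) / (1 + s0))
       + Series (fun k => Re (RtoC (2 * mu (S k) * s0 ^ S k) * w ^ S k)%C).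
Proof.
intros Hmu [Mu HMu] Hw Hs0. set (c := (1 - s0) / (1 + s0)).
set (d := fun k => poisson_coef k * Re (w ^ k)%C - match k with O => c | S _ => 0 end).
assert (B : bounded d).
{ exists (2 + Rabs c). intros k. unfold d.
  assert (B1 := poisson_bounded w Hw k).
  eapply Rle_trans; [apply Rabs_triang|]. rewrite Rabs_Ropp.
  apply Rplus_le_compat; [exact B1|]. destruct k; [lra|]. rewrite Rabs_R0. apply Rabs_pos. }
assert (Hd : forall s, 0 <= s <= s0 -> 0 <= PSeries d s).
{ intros s Hs'.
  assert (S1 := poisson_PSeries w s Hw ltac:(lra)).
  assert (S2 : is_series (fun k => match k with O => c | S _ => 0 end) c).
  { apply (is_series_single (fun k => match k with O => c | S _ => 0 end) 0).
    intros [|k] Hk; [lia|easy]. }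
  assert (S3 := is_series_minus _ _ _ _ S1 S2).
  assert (E : PSeries d s = Re ((1 + s * w) / (1 - s * w))%C - c).
  { apply is_series_unique. eapply is_series_R_ext; [|exact S3].
    intros k. unfold d. unfold minus, plus, opp; simpl. destruct k; simpl; ring. }
  rewrite E.
  assert (Hz : Cmod (s * w)%C = s) by (rewrite Cmod_mult, Cmod_R, Hw, Rabs_pos_eq; lra).
  assert (Q := poisson_Re_bound (s * w)%C ltac:(lra)). rewrite Hz in Q.
  assert (c <= (1 - s) / (1 + s)); [|lra].
  unfold c. apply Rmult_le_reg_r with (1 + s); [lra|].
  replace ((1 - s) / (1 + s) * (1 + s)) with (1 - s) by (field; lra).
  apply Rmult_le_reg_r with (1 + s0); [lra|].
  replace ((1 - s0) / (1 + s0) * (1 + s) * (1 + s0)) with ((1 - s0) * (1 + s)) by (field; lra).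
  nra. }
destruct (Hmu d s0 Hs0 B Hd) as [B2 Q].
specialize (Q s0 ltac:(lra)). unfold PSeries in Q.
assert (Hex : ex_series (fun k => mu k * d k * s0 ^ k)).
{ apply ex_series_Rabs. apply CV_disk_inside with (a := fun k => mu k * d k).
  apply bounded_CV_radius; [exact B2|]. rewrite Rabs_pos_eq; lra. }
rewrite Series_incr_1 in Q by exact Hex.
rewrite (Series_ext _ (fun k => Re (RtoC (2 * mu (S k) * s0 ^ S k) * w ^ S k)%C)) in Q.
- replace (mu O * d O * s0 ^ 0) with (mu O * (1 - c)) in Q; [exact Q|].
  unfold d. simpl. unfold Re. simpl. ring.
- intros k. rewrite re_scal_l. unfold d. simpl poisson_coef. ring.
Qed.

(** The factor [s0^k] of the kernel is absorbed by evaluating [P] at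
    [z / s0]. *)
Lemma multiplied_series_interior (P : nat -> C) (mu : nat -> R) z s0 :
  disk_summable P -> (forall y, Cmod y < 1 -> 0 <= Re (Cpseries P y)) ->
  Cmod z < s0 -> s0 < 1 ->
  positive_multiplier mu -> bounded mu ->
  0 <= 2 * (mu O * (1 - (1 - s0) / (1 + s0))) * Re (P O)
    + Series (fun k => 2 * mu (S k) * Re (P (S k) * z ^ S k)%C).
Proof.
intros HP Pos Hz Hs0 Hmu Hb. assert (H0 := Cmod_ge_0 z).
assert (Hz' : Cmod (z / s0)%C < 1).
{ rewrite Cmod_div, Cmod_R, Rabs_pos_eq by (try lra; intros F; apply RtoC_inj in F; lra).
  apply Rmult_lt_reg_r with s0; [lra|]. unfold Rdiv. rewrite Rmult_assoc, Rinv_l; lra. }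
assert (Ht : ex_series (fun k => Cmod (RtoC (2 * mu (S k) * s0 ^ S k)))).
{ destruct Hb as [M HM].
  apply ex_series_nonneg_le with (fun k => 2 * M * s0 * s0 ^ k).
  - intros k. split; [apply Cmod_ge_0|].
    assert (0 <= s0 ^ k) by (apply pow_le; lra).
    rewrite Cmod_R, !Rabs_mult, (Rabs_pos_eq 2), (Rabs_pos_eq (s0 ^ S k)) by (try lra; simpl; nra).
    generalize (HM (S k)). simpl pow. intros.
    replace (2 * M * s0 * s0 ^ k) with (2 * M * (s0 * s0 ^ k)) by ring.
    apply Rmult_le_compat_r; nra.
  - apply ex_series_mult_l. apply ex_series_geom. rewrite Rabs_pos_eq; lra. }
assert (X := positive_pairing_disk P _ _ (z / s0)%C HP Pos Hz' Ht
   (fun w Hw => kernel_lower_interior mu w s0 Hmu Hb Hw ltac:(lra))).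
rewrite (Series_ext _ (fun k => 2 * mu (S k) * Re (P (S k) * z ^ S k)%C)) in X.
- exact X.
- intros k. rewrite <- re_scal_l, Cconj_RtoC. f_equal.
  assert (Hn : RtoC s0 <> RtoC 0) by (intros F; apply RtoC_inj in F; lra).
  unfold Cdiv. rewrite Cpow_mult_l, Cpow_inv by exact Hn.
  rewrite (RtoC_mult (2 * mu (S k))), RtoC_pow. field. now apply Cpow_nz.
Qed.

(** * Algebra and growth of complex power series *)

Lemma Cpseries_0 (a : nat -> C) : Cpseries a 0 = a O.
Proof.
apply is_Cseries_unique. replace (a O) with (a O * 0 ^ 0)%C by (simpl Cpow; ring).
apply (is_Cseries_single (fun k => a k * 0 ^ k)%C).
intros [|k] Hk; [easy|]. simpl Cpow. ring.
Qed.

Lemma Cpseries_lincomb (a b : nat -> C) c z :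
  disk_summable a -> disk_summable b -> Cmod z < 1 ->
  Cpseries (fun k => a k + c * b k)%C z = (Cpseries a z + c * Cpseries b z)%C.
Proof.
intros Ha Hb Hz. apply is_Cseries_unique.
eapply is_Cseries_ext;
  [|apply is_Cseries_plus; [apply is_Cpseries|apply (is_Cseries_scal c), is_Cpseries]];
  try eassumption.
intros k. cbn beta. ring.
Qed.

Lemma disk_summable_lincomb (a b : nat -> C) c :
  disk_summable a -> disk_summable b -> disk_summable (fun k => a k + c * b k)%C.
Proof.
intros Ha Hb. apply disk_summable_plus; [exact Ha|].
apply disk_summable_le with (2 := Hb) (M := Cmod c).
intros k. rewrite Cmod_mult. lra.
Qed.

Lemma disk_summable_shift (a : nat -> C) :
  disk_summable a -> disk_summable (fun k => a (S k)).
Proof.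
intros H. apply disk_summable_le with (2 := disk_summable_deriv a H) (M := 1).
intros k. unfold Cderiv_coef. rewrite Cmod_mult, Cmod_R, Rabs_pos_eq by apply pos_INR.
rewrite S_INR. generalize (pos_INR k) (Cmod_ge_0 (a (S k))). nra.
Qed.

Lemma Cpseries_shift (a : nat -> C) z :
  disk_summable a -> Cmod z < 1 ->
  Cpseries a z = (a O + z * Cpseries (fun k => a (S k)) z)%C.
Proof.
intros Ha Hz.
assert (H1 := is_Cseries_decr _ _ (is_Cpseries a z Ha Hz)).
assert (H2 := is_Cseries_scal z _ _ (is_Cpseries _ z (disk_summable_shift a Ha) Hz)).
apply is_Cseries_unique in H1. apply is_Cseries_unique in H2.
transitivity (a O + (Cpseries a z - a O * z ^ 0))%C; [simpl Cpow; ring|].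
rewrite <- H1, <- H2. f_equal. apply Cseries_ext. intros k. simpl Cpow. ring.
Qed.

Lemma Re_Cpseries_split (a : nat -> C) z :
  disk_summable a -> Cmod z < 1 ->
  Re (Cpseries a z) = Re (a O) + Series (fun k => Re (a (S k) * z ^ S k)%C).
Proof.
intros Ha Hz. change (Re (Cpseries a z)) with (Series (fun k => Re (a k * z ^ k)%C)).
rewrite Series_incr_1.
- f_equal. change (z ^ 0)%C with (RtoC 1). now rewrite Cmult_1_r.
- now apply ex_series_Re, disk_summable_at.
Qed.

Lemma Cpseries_bound (a : nat -> C) r z :
  disk_summable a -> 0 <= r < 1 -> Cmod z <= r ->
  Cmod (Cpseries a z) <= Series (fun k => Cmod (a k) * r ^ k).
Proof.
intros Ha Hr Hz.
eapply Rle_trans.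
{ apply Cmod_is_Cseries_le; [apply is_Cpseries; [exact Ha|lra]|].
  apply disk_summable_at; [exact Ha|lra]. }
apply Series_le; [|now apply Ha].
intros k. split; [apply Cmod_ge_0|]. rewrite Cmod_mult, Cmod_pow.
apply Rmult_le_compat_l; [apply Cmod_ge_0|]. apply pow_incr. split; [apply Cmod_ge_0|easy].
Qed.

Lemma Cpseries_lipschitz (a : nat -> C) r :
  disk_summable a -> 0 <= r < 1 ->
  exists L, 0 <= L /\ forall z w, Cmod z <= r -> Cmod w <= r ->
    Cmod (Cpseries a z - Cpseries a w)%C <= L * Cmod (z - w)%C.
Proof.
intros Ha Hr. destruct (Cpseries_taylor a r Ha Hr) as [K [HK T]].
set (B := Series (fun k => Cmod (Cderiv_coef a k) * r ^ k)).
assert (HB : 0 <= B).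
{ eapply Rle_trans; [apply Cmod_ge_0|].
  apply (Cpseries_bound (Cderiv_coef a) r 0); [now apply disk_summable_deriv|easy|].
  rewrite Cmod_0; lra. }
exists (2 * K + B). split; [lra|]. intros z w Hz Hw.
specialize (T z w Hz Hw).
assert (D := Cpseries_bound _ r w (disk_summable_deriv a Ha) Hr Hw). fold B in D.
set (q := Cpseries (Cderiv_coef a) w) in *.
replace (Cpseries a z - Cpseries a w)%C with
  ((Cpseries a z - Cpseries a w - q * (z - w)) + q * (z - w))%C by ring.
eapply Rle_trans; [apply Cmod_triangle|]. rewrite Cmod_mult.
assert (U : Cmod (z - w)%C <= 2).
{ eapply Rle_trans; [apply Cmod_triangle|]. rewrite Cmod_opp. lra. }
assert (V := Cmod_ge_0 (z - w)%C).
assert (K * Cmod (z - w)%C ^ 2 <= 2 * K * Cmod (z - w)%C).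
{ replace (K * Cmod (z - w)%C ^ 2) with (K * Cmod (z - w)%C * Cmod (z - w)%C) by (simpl; ring).
  assert (0 <= K * Cmod (z - w)%C) by nra. nra. }
nra.
Qed.

(** Mean value theorem for [t |-> Re (conj eta * A(w + t eta))] with
    [eta = z - w], whose derivative is [|eta|^2 Re A'(w + t eta)]. *)
Lemma Cpseries_expanding (A : nat -> C) r c :
  disk_summable A -> 0 <= r < 1 ->
  (forall z, Cmod z <= r -> c <= Re (Cpseries (Cderiv_coef A) z)) ->
  forall z w, Cmod z <= r -> Cmod w <= r ->
  c * Cmod (z - w)%C ^ 2 <= Re (Cconj (z - w) * (Cpseries A z - Cpseries A w))%C.
Proof.
intros HA Hr Hc z w Hz Hw.
(* The Taylor estimate is taken on a larger disk so that [phi] is also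
   differentiable at the ends of the segment. *)
set (eta := (z - w)%C). set (r' := (1 + r) / 2).
destruct (Cpseries_taylor A r' HA) as [K [HK T]]; [unfold r'; lra|].
set (p := fun t : R => (w + t * eta)%C).
set (phi := fun t => Re (Cconj eta * Cpseries A (p t))%C).
set (dphi := fun t => Cmod eta ^ 2 * Re (Cpseries (Cderiv_coef A) (p t))).
assert (Hp : forall t, 0 <= t <= 1 -> Cmod (p t) <= r).
{ intros t Ht. replace (p t) with (RtoC t * z + RtoC (1 - t) * w)%C
    by (unfold p, eta; rewrite RtoC_minus; ring).
  eapply Rle_trans; [apply Cmod_triangle|].
  rewrite !Cmod_mult, !Cmod_R, !Rabs_pos_eq by lra. nra. }
assert (He : Cmod eta <= 2).
{ eapply Rle_trans; [apply Cmod_triangle|]. rewrite Cmod_opp. lra. }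
assert (He0 := Cmod_ge_0 eta).
assert (Hd : forall t, 0 <= t <= 1 -> is_derive phi t (dphi t)).
{ intros t Ht. apply is_derive_Reals. intros eps Heps.
  set (del := Rmin ((1 - r) / 4) (eps / (8 * K + 1))).
  assert (Hdel : 0 < del).
  { apply Rmin_pos; [lra|]. apply Rdiv_lt_0_compat; lra. }
  exists (mkposreal _ Hdel). simpl. intros u Hu Hu'.
  assert (U1 : Rabs u < (1 - r) / 4) by (eapply Rlt_le_trans; [exact Hu'|apply Rmin_l]).
  assert (U2 : Rabs u < eps / (8 * K + 1)) by (eapply Rlt_le_trans; [exact Hu'|apply Rmin_r]).
  assert (P1 : Cmod (p t) <= r') by (unfold r'; generalize (Hp t Ht); lra).
  assert (P2 : Cmod (p (t + u)%R) <= r').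
  { replace (p (t + u)%R) with (p t + u * eta)%C by (unfold p; rewrite RtoC_plus; ring).
    eapply Rle_trans; [apply Cmod_triangle|]. rewrite Cmod_mult, Cmod_R.
    generalize (Hp t Ht) (Rabs_pos u). unfold r'. nra. }
  specialize (T _ _ P2 P1).
  replace (p (t + u)%R - p t)%C with (u * eta)%C in T by (unfold p; rewrite RtoC_plus; ring).
  set (E := (Cpseries A (p (t + u)%R) - Cpseries A (p t)
             - Cpseries (Cderiv_coef A) (p t) * (u * eta))%C) in T.
  assert (Q : phi (t + u) - phi t - u * dphi t = Re (Cconj eta * E)%C).
  { unfold phi, dphi, E.
    replace (Cconj eta * (Cpseries A (p (t + u)%R) - Cpseries A (p t)
      - Cpseries (Cderiv_coef A) (p t) * (u * eta)))%C
     with (Cconj eta * Cpseries A (p (t + u)%R) + - (Cconj eta * Cpseries A (p t))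
       + - (RtoC u * ((eta * Cconj eta) * Cpseries (Cderiv_coef A) (p t))))%C by ring.
    rewrite !re_plus, !re_opp, re_scal_l, <- Cmod2_conj, re_scal_l. ring. }
  assert (Q2 : Rabs (phi (t + u) - phi t - u * dphi t) <= 8 * K * Rabs u ^ 2).
  { rewrite Q. eapply Rle_trans; [apply re_le_Cmod|]. rewrite Cmod_mult, Cmod_conj.
    eapply Rle_trans; [apply Rmult_le_compat_l; [apply He0|apply T]|].
    rewrite Cmod_mult, Cmod_R, Rpow_mult_distr.
    assert (Cmod eta ^ 3 <= 2 ^ 3) by (apply pow_incr; lra).
    assert (0 <= K * Rabs u ^ 2) by (apply Rmult_le_pos; [exact HK|apply pow2_ge_0]).
    replace (Cmod eta * (K * (Rabs u ^ 2 * Cmod eta ^ 2)))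
      with (K * Rabs u ^ 2 * Cmod eta ^ 3) by ring.
    replace (8 * K * Rabs u ^ 2) with (K * Rabs u ^ 2 * 2 ^ 3) by ring.
    now apply Rmult_le_compat_l. }
  replace ((phi (t + u) - phi t) / u - dphi t)
    with ((phi (t + u) - phi t - u * dphi t) / u) by (field; exact Hu).
  unfold Rdiv. rewrite Rabs_mult, Rabs_inv.
  assert (Hu0 : 0 < Rabs u) by now apply Rabs_pos_lt.
  apply Rmult_lt_reg_r with (Rabs u); [exact Hu0|].
  rewrite Rmult_assoc, Rinv_l, Rmult_1_r by lra.
  eapply Rle_lt_trans; [exact Q2|].
  apply Rmult_lt_compat_r with (r := 8 * K + 1) in U2; [|lra].
  unfold Rdiv in U2. rewrite Rmult_assoc, Rinv_l, Rmult_1_r in U2 by lra. simpl. nra. }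
destruct (MVT_gen phi 0 1 dphi) as [t [Ht E]].
- intros x Hx. rewrite Rmin_left, Rmax_right in Hx by lra. apply Hd; lra.
- intros x Hx. rewrite Rmin_left, Rmax_right in Hx by lra.
  apply continuity_pt_filterlim. apply (ex_derive_continuous (V := R_NormedModule)).
  exists (dphi x). apply Hd; lra.
- rewrite Rmin_left, Rmax_right in Ht by lra.
  assert (E0 : Re (Cconj eta * (Cpseries A z - Cpseries A w))%C = phi 1 - phi 0).
  { unfold phi. replace (p 1) with z by (unfold p, eta; ring).
    replace (p 0) with w by (unfold p, eta; ring).
    unfold Rminus. rewrite <- re_opp, <- re_plus. f_equal. ring. }
  rewrite E0, E. unfold dphi.
  generalize (Hc (p t) (Hp t Ht)) (pow2_ge_0 (Cmod eta)). nra.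
Qed.

(** * Surjectivity of strongly monotone maps *)

(** Expand [|v - tau u|^2 = |v|^2 - 2 tau Re (conj v * u) + tau^2 |u|^2]; for small
    [tau] the linear gain [m] beats the quadratic term, at the price of lowering
    [m] to [m']. *)
Lemma Cmod_step (v u : C) tau m m' L :
  m' <= m -> 0 < tau -> tau * m' <= 1 -> tau * L ^ 2 <= 2 * (m - m') ->
  m * Cmod v ^ 2 <= Re (Cconj v * u)%C -> Cmod u <= L * Cmod v ->
  Cmod (v - tau * u)%C <= (1 - tau * m') * Cmod v.
Proof.
intros Hm Ht Ht1 HtL Hu HL.
assert (E : Cmod (v - tau * u)%C ^ 2
  = Cmod v ^ 2 - 2 * tau * Re (Cconj v * u)%C + tau ^ 2 * Cmod u ^ 2).
{ rewrite !Cmod2_alt. destruct v, u. unfold Re, Im. simpl. ring. }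
assert (Hv := Cmod_ge_0 v). assert (Hu0 := Cmod_ge_0 u).
assert (U2 : Cmod u ^ 2 <= L ^ 2 * Cmod v ^ 2).
{ rewrite <- Rpow_mult_distr. apply pow_incr. lra. }
assert (S : Cmod (v - tau * u)%C ^ 2 <= ((1 - tau * m') * Cmod v) ^ 2).
{ rewrite E. set (V := Cmod v ^ 2) in *. assert (0 <= V) by apply pow2_ge_0.
  set (W := Cmod u ^ 2) in *. set (X := Re (Cconj v * u)%C) in *.
  replace (((1 - tau * m') * Cmod v) ^ 2) with ((1 - tau * m') ^ 2 * V) by (unfold V; ring).
  assert (tau ^ 2 * W <= tau * (2 * (m - m')) * V).
  { apply Rle_trans with (tau ^ 2 * (L ^ 2 * V)).
    - apply Rmult_le_compat_l; [apply pow2_ge_0|exact U2].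
    - replace (tau ^ 2 * (L ^ 2 * V)) with (tau * (tau * L ^ 2) * V) by ring.
      apply Rmult_le_compat_r; [easy|]. apply Rmult_le_compat_l; lra. }
  assert (tau * (m * V) <= tau * X) by (apply Rmult_le_compat_l; lra).
  assert (0 <= (tau * m') ^ 2 * V) by (apply Rmult_le_pos; [apply pow2_ge_0|easy]).
  nra. }
apply Rsqr_incr_0_var; [unfold Rsqr; simpl in S; lra|]. apply Rmult_le_pos; lra.
Qed.

Lemma is_Cseries_eps (u : nat -> C) l :
  is_Cseries u l -> forall eps, 0 < eps ->
  exists N, forall n, (N <= n)%nat -> Cmod (sum_n u n - l)%C < eps.
Proof.
intros H eps He.
apply (H (fun y => Cmod (y - l)%C < eps)).
apply locally_Cmod. exists eps. split; [exact He|easy].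
Qed.

(** The map [x |-> x - tau (f x - w)] has the solutions of [f x = w] as fixed
    points. [Cmod_step] applied to differences makes it a contraction; applied to
    [x] and [f x] it shows that the disk of radius [r] is preserved, because
    [(1 - tau G') r + tau |w| <= r]. *)
Lemma strongly_monotone_onto (f : C -> C) r c L G G' w :
  0 <= r -> 0 < c -> 0 <= G' < G ->
  (forall x y, Cmod x <= r -> Cmod y <= r ->
     c * Cmod (x - y)%C ^ 2 <= Re (Cconj (x - y) * (f x - f y))%C) ->
  (forall x y, Cmod x <= r -> Cmod y <= r -> Cmod (f x - f y)%C <= L * Cmod (x - y)%C) ->
  f (RtoC 0) = RtoC 0 ->
  (forall x, Cmod x <= r -> G * Cmod x ^ 2 <= Re (Cconj x * f x)%C) ->
  Cmod w <= G' * r ->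
  exists x, Cmod x <= r /\ f x = w.
Proof.
intros Hr Hc HG Mono Lip f0 Grow Hw.
assert (HL2 : 0 <= L ^ 2) by apply pow2_ge_0.
(* The three bounds are the smallness conditions of [Cmod_step] for the invariance
   of the disk and for the contraction with constant c / 2. *)
set (tau := Rmin (/ (G' + c + 1)) (Rmin (2 * (G - G') / (L ^ 2 + 1)) (c / (L ^ 2 + 1)))).
assert (Ht : 0 < tau).
{ unfold tau. repeat apply Rmin_pos.
  - apply Rinv_0_lt_compat; lra.
  - apply Rdiv_lt_0_compat; lra.
  - apply Rdiv_lt_0_compat; lra. }
assert (T1 : tau * (G' + c + 1) <= 1).
{ apply Rle_trans with (/ (G' + c + 1) * (G' + c + 1)).
  - apply Rmult_le_compat_r; [lra|apply Rmin_l].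
  - rewrite Rinv_l; lra. }
assert (T2 : tau * (L ^ 2 + 1) <= 2 * (G - G')).
{ replace (2 * (G - G')) with (2 * (G - G') / (L ^ 2 + 1) * (L ^ 2 + 1)) by (field; lra).
  apply Rmult_le_compat_r; [lra|]. eapply Rle_trans; [apply Rmin_r|apply Rmin_l]. }
assert (T3 : tau * (L ^ 2 + 1) <= c).
{ apply Rle_trans with (c / (L ^ 2 + 1) * (L ^ 2 + 1)); [|right; field; lra].
  apply Rmult_le_compat_r; [lra|]. eapply Rle_trans; [apply Rmin_r|apply Rmin_r]. }
set (Psi := fun x => (x - tau * (f x - w))%C).
assert (Zr : Cmod 0 <= r) by (rewrite Cmod_0; exact Hr).
assert (Stay : forall x, Cmod x <= r -> Cmod (Psi x) <= r).
{ intros x Hx.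
  replace (Psi x) with ((x - tau * f x) + tau * w)%C by (unfold Psi; ring).
  assert (S := Cmod_step x (f x) tau G G' L ltac:(lra) Ht ltac:(nra) ltac:(nra) (Grow x Hx)).
  assert (HfL := Lip x 0%C Hx Zr). rewrite f0 in HfL.
  replace (f x - 0)%C with (f x) in HfL by ring. replace (x - 0)%C with x in HfL by ring.
  specialize (S HfL).
  eapply Rle_trans; [apply Cmod_triangle|]. rewrite Cmod_mult, Cmod_R, (Rabs_pos_eq tau) by lra.
  assert ((1 - tau * G') * Cmod x <= (1 - tau * G') * r)
    by (apply Rmult_le_compat_l; [nra|exact Hx]).
  assert (tau * Cmod w <= tau * (G' * r)) by (apply Rmult_le_compat_l; lra).
  lra. }
set (q := 1 - tau * (c / 2)).
assert (Hq : 0 <= q < 1) by (unfold q; nra).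
assert (Contr : forall x y, Cmod x <= r -> Cmod y <= r ->
   Cmod (Psi x - Psi y)%C <= q * Cmod (x - y)%C).
{ intros x y Hx Hy.
  replace (Psi x - Psi y)%C with ((x - y) - tau * (f x - f y))%C by (unfold Psi; ring).
  apply Cmod_step with c L; try assumption; [lra|nra|lra|now apply Mono|now apply Lip]. }
set (x := fix x n := match n with O => RtoC 0 | S n => Psi (x n) end).
assert (Hx : forall n, Cmod (x n) <= r).
{ induction n as [|n IH]; [exact Zr|]. simpl. now apply Stay. }
set (u := fun n => (x (S n) - x n)%C).
assert (Hu : forall n, Cmod (u n) <= Cmod (u O) * q ^ n).
{ induction n as [|n IH]; [simpl; lra|].
  eapply Rle_trans; [apply (Contr (x (S n)) (x n) (Hx _) (Hx _))|].
  fold (u n). simpl pow. nra. }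
assert (Eu : ex_series (fun n => Cmod (u n))).
{ apply ex_series_nonneg_le with (fun n => Cmod (u O) * q ^ n).
  - intros n. split; [apply Cmod_ge_0|apply Hu].
  - apply ex_series_mult_l, ex_series_geom. rewrite Rabs_pos_eq; lra. }
set (l := Cseries u).
assert (Su : forall n, @eq C (sum_n u n) (x (S n))).
{ induction n as [|n IH].
  - rewrite sum_O. unfold u. change (x O) with (RtoC 0). ring.
  - rewrite sum_n_CS, IH. unfold u. ring. }
assert (Lim : forall eps, 0 < eps -> exists N, forall n, (N <= n)%nat -> Cmod (x (S n) - l)%C < eps).
{ intros eps He. destruct (is_Cseries_eps u l (is_Cseries_abs u Eu) eps He) as [N HN].
  exists N. intros n Hn. rewrite <- Su. now apply HN. }
assert (Hl : Cmod l <= r).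
{ destruct (Rle_or_lt (Cmod l) r) as [Q|Q]; [exact Q|exfalso].
  destruct (Lim (Cmod l - r) ltac:(lra)) as [N HN]. specialize (HN N (Nat.le_refl N)).
  assert (T := Cmod_triangle (- (x (S N) - l)) (x (S N))).
  replace (- (x (S N) - l) + x (S N))%C with l in T by ring.
  rewrite Cmod_opp in T. generalize (Hx (S N)). lra. }
exists l. split; [exact Hl|].
assert (Fix : Psi l = l).
{ destruct (Req_dec (Cmod (Psi l - l)%C) 0) as [Q|Q].
  - apply Cmod_eq_0 in Q. replace (Psi l) with (Psi l - l + l)%C by ring. rewrite Q. ring.
  - exfalso. assert (Q0 := Cmod_ge_0 (Psi l - l)%C).
    destruct (Lim (Cmod (Psi l - l)%C / 2) ltac:(lra)) as [N HN].
    assert (H1 := HN N ltac:(lia)). assert (H2 := HN (S N) ltac:(lia)).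
    assert (H3 := Contr l (x (S N)) Hl (Hx _)).
    change (x (S (S N))) with (Psi (x (S N))) in H2.
    assert (T := Cmod_triangle (Psi l - Psi (x (S N)))%C (Psi (x (S N)) - l)%C).
    replace (Psi l - Psi (x (S N)) + (Psi (x (S N)) - l))%C with (Psi l - l)%C in T by ring.
    assert (H4 : Cmod (l - x (S N))%C = Cmod (x (S N) - l)%C).
    { rewrite <- Cmod_opp. f_equal. ring. }
    rewrite H4 in H3. generalize (Cmod_ge_0 (x (S N) - l)%C). nra. }
unfold Psi in Fix.
assert (Ht' : RtoC tau <> RtoC 0) by (intros F; apply RtoC_inj in F; lra).
replace (f l) with (/ tau * (l - (l - tau * (f l - w))) + w)%C by (field; exact Ht').
rewrite Fix. field. exact Ht'.
Qed.

(** * Coefficients, growth and covering for the class *)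

(** Comparison with a telescoping series. *)
Lemma ex_series_inv_square : ex_series (fun k => / INR (S k) ^ 2).
Proof.
apply ex_series_nonneg_le with (fun k => 2 * (/ (INR k + 1) - / (INR k + 2))).
- intros k. rewrite S_INR. assert (H := pos_INR k). split.
  + apply Rlt_le, Rinv_0_lt_compat. nra.
  + apply Rmult_le_reg_r with ((INR k + 1) ^ 2 * (INR k + 2)); [nra|].
    replace (/ (INR k + 1) ^ 2 * ((INR k + 1) ^ 2 * (INR k + 2))) with (INR k + 2)
      by (field; lra).
    replace (2 * (/ (INR k + 1) - / (INR k + 2)) * ((INR k + 1) ^ 2 * (INR k + 2)))
      with (2 * (INR k + 1)) by (field; lra). lra.
- apply ex_series_mult_l. exists (1 - 0).
  assert (E : forall n, @eq R (sum_n (fun k => / (INR k + 1) - / (INR k + 2)) n)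
                              (1 - / (INR n + 2))).
  { induction n as [|n IH].
    - rewrite sum_O. simpl. field.
    - rewrite sum_n_RS, IH, S_INR. generalize (pos_INR n). intros. field. lra. }
  change (is_lim_seq (fun n => sum_n (fun k => / (INR k + 1) - / (INR k + 2)) n) (1 - 0)).
  apply is_lim_seq_ext with (fun n => 1 - / (INR n + 2)); [intros n; now rewrite E|].
  apply is_lim_seq_minus'; [apply is_lim_seq_const|].
  apply (is_lim_seq_inv _ p_infty); [|discriminate].
  apply is_lim_seq_plus with p_infty 2; [apply is_lim_seq_INR|apply is_lim_seq_const|easy].
Qed.

Section Family.
Variables gam del lam : R.
Hypothesis (Hlam : 0 <= lam) (Hgam : lam < gam) (Hdel : gam <= del).

Lemma linear_factor_ge m : (1 <= m)%nat -> 2 * gam <= 2 * gam + (del - gam) * (INR m - 1).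
Proof.
intros Hm. apply le_INR in Hm. simpl in Hm.
assert (0 <= (del - gam) * (INR m - 1)) by (apply Rmult_le_pos; lra). lra.
Qed.

Lemma denom_ge m : (1 <= m)%nat -> 2 * gam * INR m ^ 2 <= denom gam del m.
Proof.
intros Hm. unfold denom. rewrite Rmult_comm.
apply Rmult_le_compat_l; [apply pow2_ge_0|now apply linear_factor_ge].
Qed.

Lemma denom_pos m : (1 <= m)%nat -> 0 < denom gam del m.
Proof.
intros Hm. eapply Rlt_le_trans; [|now apply denom_ge].
apply le_INR in Hm. simpl in Hm. apply Rmult_lt_0_compat; [lra|]. apply pow_lt; lra.
Qed.

Lemma ex_series_inv_denom : ex_series (fun k => Rabs (/ denom gam del (S k))).
Proof.
apply ex_series_nonneg_le with (fun k => / (2 * gam) * / INR (S k) ^ 2).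
- intros k. split; [apply Rabs_pos|].
  assert (H := denom_pos (S k) ltac:(lia)).
  rewrite Rabs_pos_eq by now apply Rlt_le, Rinv_0_lt_compat.
  rewrite <- Rinv_mult. apply Rinv_le_contravar; [|apply denom_ge; lia].
  apply Rmult_lt_0_compat; [lra|]. apply pow_lt, lt_0_INR. lia.
- apply ex_series_mult_l, ex_series_inv_square.
Qed.

(** [denom gam del (k+1) = (k+1) (k+1) (2 gam + (del - gam) k)] is a product of
    three linear factors. *)
Lemma positive_multiplier_denom : positive_multiplier (fun k => / denom gam del (S k)).
Proof.
assert (H1 := positive_multiplier_inv_linear 1 1 ltac:(lra) ltac:(lra)).
assert (H2 := positive_multiplier_inv_linear (2 * gam) (del - gam) ltac:(lra) ltac:(lra)).
eapply positive_multiplier_ext;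
  [|exact (positive_multiplier_mult _ _ H1 (positive_multiplier_mult _ _ H1 H2))].
intros k. cbn beta. rewrite <- !Rinv_mult. f_equal. unfold denom. rewrite S_INR. ring.
Qed.

(** The factor of [P_k] in the derivative, up to 2: differentiation cancels one
    factor [k+1] of [denom gam del (k+1)]. *)
Definition deriv_multiplier (k : nat) : R :=
  / (INR (S k) * (2 * gam + (del - gam) * INR k)).

Lemma deriv_denom_ge k : 2 * gam <= INR (S k) * (2 * gam + (del - gam) * INR k).
Proof.
assert (H := linear_factor_ge (S k) ltac:(lia)).
rewrite S_INR in *. assert (Hk := pos_INR k).
replace (INR k + 1 - 1) with (INR k) in H by ring. nra.
Qed.

Lemma positive_multiplier_deriv : positive_multiplier deriv_multiplier.
Proof.
assert (H1 := positive_multiplier_inv_linear 1 1 ltac:(lra) ltac:(lra)).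
assert (H2 := positive_multiplier_inv_linear (2 * gam) (del - gam) ltac:(lra) ltac:(lra)).
eapply positive_multiplier_ext; [|exact (positive_multiplier_mult _ _ H1 H2)].
intros k. cbn beta. unfold deriv_multiplier. rewrite <- !Rinv_mult. f_equal.
rewrite S_INR. ring.
Qed.

Lemma deriv_multiplier_bounded : bounded deriv_multiplier.
Proof.
exists (/ (2 * gam)). intros k. assert (H := deriv_denom_ge k). unfold deriv_multiplier.
rewrite Rabs_pos_eq by (apply Rlt_le, Rinv_0_lt_compat; lra).
apply Rinv_le_contravar; lra.
Qed.

Definition alt_sum : R := Series_from 2 (fun m => (-1) ^ (m - 1) / denom gam del m).
(** Minus the value at [-1] of the extremal map. *)
Definition covering_radius : R := 1 + 4 * (gam - lam) * alt_sum.

Lemma alt_sum_eq : alt_sum = Series (fun k => (-1) ^ S k * / denom gam del (S (S k))).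
Proof.
apply Series_ext. intros k. replace (2 + k - 1)%nat with (S k) by lia. reflexivity.
Qed.

Section Class.
Variables (h g : C -> C) (a b : nat -> C).
Hypothesis Hf : class_RH0 gam del lam h g a b.

Let H0 := proj1 Hf.
Let Eh := H0_expansion_h _ _ _ _ H0.
Let Eg := H0_expansion_g _ _ _ _ H0.
Let Sa := power_expansion_summable _ _ Eh.
Let Sb := power_expansion_summable _ _ Eg.

Let Z01 : Cmod (RtoC 0) < 1. Proof. rewrite Cmod_0; lra. Qed.

Lemma class_coef_h : a O = RtoC 0 /\ a 1%nat = RtoC 1.
Proof.
split.
- rewrite <- Cpseries_0, <- (power_expansion_eq h a _ Eh Z01). apply (H0_h_0 _ _ _ _ H0).
- assert (E := C_derive_power_expansion h a _ Eh Z01).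
  rewrite (H0_dh_0 _ _ _ _ H0), Cpseries_0 in E. unfold Cderiv_coef in E.
  rewrite E. simpl. ring.
Qed.

Lemma class_coef_g : b O = RtoC 0 /\ b 1%nat = RtoC 0.
Proof.
split.
- rewrite <- Cpseries_0, <- (power_expansion_eq g b _ Eg Z01). apply (H0_g_0 _ _ _ _ H0).
- assert (E := C_derive_power_expansion g b _ Eg Z01).
  rewrite (H0_dg_0 _ _ _ _ H0), Cpseries_0 in E. unfold Cderiv_coef in E.
  rewrite E. simpl. ring.
Qed.

Section Rotation.
Variable e : C.
Hypothesis He : Cmod e = 1.

(** Coefficients of the analytic function [h + e g]. *)
Definition mixed_coef (k : nat) : C := (a k + e * b k)%C.

(** Coefficients of [op h - lam + e op g]. *)
Definition caratheodory_coef (k : nat) : C :=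
  (op_coef gam del a k + e * op_coef gam del b k
   + (- RtoC lam) * match k with O => 1 | S _ => 0 end)%C.

Lemma mixed_summable : disk_summable mixed_coef.
Proof. now apply disk_summable_lincomb. Qed.

Lemma mixed_coef_1 : mixed_coef 1 = RtoC 1.
Proof.
unfold mixed_coef. rewrite (proj2 class_coef_h), (proj2 class_coef_g). ring.
Qed.

Lemma mixed_coef_0 : mixed_coef 0 = RtoC 0.
Proof.
unfold mixed_coef. rewrite (proj1 class_coef_h), (proj1 class_coef_g). ring.
Qed.

Lemma caratheodory_summable : disk_summable caratheodory_coef.
Proof.
assert (Sh := power_expansion_summable _ _ (third_order_op_expansion gam del h a Eh)).
assert (Sg := power_expansion_summable _ _ (third_order_op_expansion gam del g b Eg)).
apply (disk_summable_lincomb (fun k => (op_coef gam del a k + e * op_coef gam del b k)%C)).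
- now apply disk_summable_lincomb.
- intros r Hr. eexists. apply (is_series_single _ 0). intros [|k] Hk; [easy|].
  rewrite Cmod_0. apply Rmult_0_l.
Qed.

Lemma caratheodory_Re_pos y : Cmod y < 1 -> 0 <= Re (Cpseries caratheodory_coef y).
Proof.
intros Hy.
assert (Xh := third_order_op_expansion gam del h a Eh).
assert (Xg := third_order_op_expansion gam del g b Eg).
rewrite power_expansion_iff in Xh, Xg.
assert (E : Cpseries caratheodory_coef y
   = (third_order_op gam del h y - lam + e * third_order_op gam del g y)%C).
{ apply is_Cseries_unique.
  replace (third_order_op gam del h y - lam + e * third_order_op gam del g y)%C
    with (third_order_op gam del h y + e * third_order_op gam del g y + (- lam) * 1)%C by ring.
  eapply is_Cseries_ext; [|apply is_Cseries_plus; [apply is_Cseries_plus;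
     [apply (Xh y Hy)|apply (is_Cseries_scal e), (Xg y Hy)]
     |apply (is_Cseries_scal (- RtoC lam)%C),
      (is_Cseries_single (fun k => match k with O => RtoC 1 | S _ => RtoC 0 end) 0)]].
  - intros k. cbn beta. unfold caratheodory_coef. destruct k; simpl Cpow; ring.
  - now intros [|k] Hk. }
rewrite E, re_plus.
assert (X := proj2 Hf y Hy). unfold Rgt in X.
assert (Y := re_le_Cmod (e * third_order_op gam del g y)%C).
rewrite Cmod_mult, He, Rmult_1_l in Y.
assert (Z := Rle_abs (- Re (e * third_order_op gam del g y)%C)). rewrite Rabs_Ropp in Z. lra.
Qed.

Lemma caratheodory_coef_0 : caratheodory_coef 0 = RtoC (gam - lam).
Proof.
unfold caratheodory_coef, op_coef.
rewrite (proj2 class_coef_h), (proj2 class_coef_g).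
replace (denom gam del 1 / 2) with gam by (unfold denom; simpl; field).
rewrite RtoC_minus. ring.
Qed.

Lemma mixed_coef_caratheodory k :
  mixed_coef (S (S k)) = (RtoC (2 * / denom gam del (S (S k))) * caratheodory_coef (S k))%C.
Proof.
unfold mixed_coef, caratheodory_coef, op_coef.
assert (H := denom_pos (S (S k)) ltac:(lia)).
replace (RtoC (2 * / denom gam del (S (S k)))) with (/ RtoC (denom gam del (S (S k)) / 2))%C.
- assert (N : RtoC (denom gam del (S (S k)) / 2) <> RtoC 0)
    by (intros F; apply RtoC_inj in F; lra).
  field. exact N.
- rewrite <- RtoC_inv by lra. f_equal. field. lra.
Qed.

(** [2 / d_m] times the Caratheodory bound [2 (gam - lam)]. *)
Lemma mixed_coef_bound k :
  Cmod (mixed_coef (S (S k))) <= 4 * (gam - lam) / denom gam del (S (S k)).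
Proof.
assert (X := caratheodory_bound _ k caratheodory_summable caratheodory_Re_pos).
rewrite caratheodory_coef_0, re_RtoC in X.
assert (H := denom_pos (S (S k)) ltac:(lia)).
assert (H' := Rinv_0_lt_compat _ H).
rewrite mixed_coef_caratheodory, Cmod_mult, Cmod_R, Rabs_pos_eq by lra.
unfold Rdiv. nra.
Qed.

(** [conj z * F z = |z|^2 * (F z / z)], and the coefficients of [F z / z] beyond
    the first are [2 / d_(k+1)] times those of a function with positive real
    part. *)
Lemma mixed_growth z :
  Cmod z < 1 ->
  covering_radius * Cmod z ^ 2 <= Re (Cconj z * Cpseries mixed_coef z)%C.
Proof.
intros Hz.
assert (X := multiplied_series_endpoint _ _ z caratheodory_summable caratheodory_Re_pos Hz
  positive_multiplier_denom ex_series_inv_denom).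
cbv beta in X. rewrite <- alt_sum_eq, caratheodory_coef_0, re_RtoC in X.
rewrite (Cpseries_shift _ z mixed_summable Hz), mixed_coef_0.
set (Q := Cpseries (fun k => mixed_coef (S k)) z).
replace (Cconj z * (0 + z * Q))%C with (z * Cconj z * Q)%C by ring.
rewrite <- Cmod2_conj, re_scal_l, Rmult_comm.
apply Rmult_le_compat_l; [apply pow2_ge_0|].
unfold Q. rewrite (Re_Cpseries_split _ z (disk_summable_shift _ mixed_summable) Hz).
rewrite mixed_coef_1, re_RtoC. unfold covering_radius. apply Rplus_le_compat_l.
eapply Rle_trans; [exact X|]. right. apply Series_ext. intros k.
rewrite mixed_coef_caratheodory, <- Cmult_assoc, re_scal_l. reflexivity.
Qed.

(** As for [mixed_growth], with the multiplier of the derivative. The left-hand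
    side equals [lam / gam + (1 - lam / gam) (1-s0)/(1+s0)], which is positive. *)
Lemma mixed_deriv_lower z s0 :
  Cmod z < s0 -> s0 < 1 ->
  1 - (1 - (1 - s0) / (1 + s0)) * (gam - lam) / gam <= Re (Cpseries (Cderiv_coef mixed_coef) z).
Proof.
intros Hz Hs0.
assert (X := multiplied_series_interior _ _ z s0 caratheodory_summable caratheodory_Re_pos Hz Hs0
  positive_multiplier_deriv deriv_multiplier_bounded).
rewrite caratheodory_coef_0, re_RtoC in X.
rewrite (Re_Cpseries_split _ z (disk_summable_deriv _ mixed_summable) ltac:(lra)).
replace (Cderiv_coef mixed_coef 0) with (RtoC 1)
  by (unfold Cderiv_coef; rewrite mixed_coef_1; simpl; ring).
rewrite re_RtoC.
rewrite (Series_ext (fun k => Re (Cderiv_coef mixed_coef (S k) * z ^ S k)%C)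
  (fun k => 2 * deriv_multiplier (S k) * Re (caratheodory_coef (S k) * z ^ S k)%C)).
- replace (deriv_multiplier 0) with (/ (2 * gam)) in X
    by (unfold deriv_multiplier; simpl; f_equal; ring).
  replace (2 * (/ (2 * gam) * (1 - (1 - s0) / (1 + s0))) * (gam - lam))
    with ((1 - (1 - s0) / (1 + s0)) * (gam - lam) / gam) in X
    by (field; generalize (Cmod_ge_0 z); lra).
  lra.
- intros k. rewrite <- re_scal_l. f_equal. unfold Cderiv_coef.
  rewrite mixed_coef_caratheodory.
  replace (2 * deriv_multiplier (S k)) with (INR (S (S k)) * (2 * / denom gam del (S (S k)))).
  + rewrite (RtoC_mult (INR (S (S k)))). ring.
  + unfold deriv_multiplier, denom.
    assert (N1 : INR (S (S k)) <> 0) by (apply not_0_INR; lia).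
    assert (N2 := linear_factor_ge (S (S k)) ltac:(lia)).
    replace (INR (S (S k)) - 1) with (INR (S k)) in * by (rewrite (S_INR (S k)); ring).
    field. split; [lra|exact N1].
Qed.

End Rotation.

(** With [e = eta / conj eta], [conj eta * e v = eta v] has the same real part as
    its conjugate [conj eta * conj v]. In the direction [eta] the harmonic map
    [h + conj g] is thus controlled by the analytic function [h + e g]. *)
Lemma aligned_rotation (eta : C) :
  exists e, Cmod e = 1 /\
    forall u v, Re (Cconj eta * (u + Cconj v))%C = Re (Cconj eta * (u + e * v))%C.
Proof.
destruct (Req_dec (Cmod eta) 0) as [N|N].
- exists (RtoC 1). split; [apply Cmod_1|]. intros u v. apply Cmod_eq_0 in N. rewrite N.
  now rewrite Cconj_RtoC, !Cmult_0_l.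
- assert (N1 : Cconj eta <> RtoC 0).
  { intros F. apply N. rewrite <- Cmod_conj, F. apply Cmod_0. }
  exists (eta / Cconj eta)%C. split.
  + rewrite Cmod_div, Cmod_conj by exact N1. now field.
  + intros u v.
    replace (Cconj eta * (u + eta / Cconj eta * v))%C with (Cconj eta * u + eta * v)%C
      by (field; exact N1).
    rewrite Cmult_plus_distr_l, !re_plus. f_equal.
    rewrite <- Cmult_conj, re_conj. reflexivity.
Qed.

Lemma harmonic_eq z : Cmod z < 1 ->
  harmonic_of h g z = (Cpseries a z + Cconj (Cpseries b z))%C.
Proof.
intros Hz. unfold harmonic_of.
now rewrite (power_expansion_eq h a z Eh Hz), (power_expansion_eq g b z Eg Hz).
Qed.

Lemma mixed_Cpseries e z : Cmod z < 1 ->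
  Cpseries (mixed_coef e) z = (Cpseries a z + e * Cpseries b z)%C.
Proof. intros Hz. now apply Cpseries_lincomb. Qed.

Lemma harmonic_growth z : Cmod z < 1 ->
  covering_radius * Cmod z ^ 2 <= Re (Cconj z * harmonic_of h g z)%C.
Proof.
intros Hz. destruct (aligned_rotation z) as [e [He E]].
rewrite harmonic_eq, E, <- mixed_Cpseries by exact Hz. now apply mixed_growth.
Qed.

Lemma harmonic_expanding r : 0 <= r < 1 ->
  exists c, 0 < c /\ forall x y, Cmod x <= r -> Cmod y <= r ->
    c * Cmod (x - y)%C ^ 2 <= Re (Cconj (x - y) * (harmonic_of h g x - harmonic_of h g y))%C.
Proof.
intros Hr. set (s0 := (1 + r) / 2). set (c0 := (1 - s0) / (1 + s0)).
assert (Hs0 : 0 < s0 < 1) by (unfold s0; lra).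
assert (Hc0 : 0 < c0).
{ unfold c0. apply Rdiv_lt_0_compat; lra. }
set (c := 1 - (1 - c0) * (gam - lam) / gam). exists c. split.
{ unfold c. apply Rmult_lt_reg_r with gam; [lra|].
  replace ((1 - (1 - c0) * (gam - lam) / gam) * gam) with (lam + c0 * (gam - lam))
    by (field; lra).
  assert (0 < c0 * (gam - lam)) by (apply Rmult_lt_0_compat; lra). lra. }
intros x y Hx Hy. destruct (aligned_rotation (x - y)) as [e [He E]].
assert (X := Cpseries_expanding (mixed_coef e) r c (mixed_summable e) Hr).
rewrite !harmonic_eq by lra.
replace (Cpseries a x + Cconj (Cpseries b x) - (Cpseries a y + Cconj (Cpseries b y)))%C
  with ((Cpseries a x - Cpseries a y) + Cconj (Cpseries b x - Cpseries b y))%C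
  by (rewrite Cminus_conj; ring).
rewrite E.
replace (Cpseries a x - Cpseries a y + e * (Cpseries b x - Cpseries b y))%C
  with (Cpseries (mixed_coef e) x - Cpseries (mixed_coef e) y)%C
  by (rewrite !mixed_Cpseries by lra; ring).
apply X; [|exact Hx|exact Hy]. intros z Hz. apply (mixed_deriv_lower e He); unfold s0; lra.
Qed.

Lemma harmonic_lipschitz r : 0 <= r < 1 ->
  exists L, 0 <= L /\ forall x y, Cmod x <= r -> Cmod y <= r ->
    Cmod (harmonic_of h g x - harmonic_of h g y)%C <= L * Cmod (x - y)%C.
Proof.
intros Hr. destruct (Cpseries_lipschitz a r Sa Hr) as [La [HLa Pa]].
destruct (Cpseries_lipschitz b r Sb Hr) as [Lb [HLb Pb]].
exists (La + Lb). split; [lra|]. intros x y Hx Hy. rewrite !harmonic_eq by lra.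
replace (Cpseries a x + Cconj (Cpseries b x) - (Cpseries a y + Cconj (Cpseries b y)))%C
  with ((Cpseries a x - Cpseries a y) + Cconj (Cpseries b x - Cpseries b y))%C
  by (rewrite Cminus_conj; ring).
eapply Rle_trans; [apply Cmod_triangle|]. rewrite Cmod_conj.
generalize (Pa x y Hx Hy) (Pb x y Hx Hy). lra.
Qed.

Lemma harmonic_0 : harmonic_of h g 0 = RtoC 0.
Proof.
unfold harmonic_of. rewrite (H0_h_0 _ _ _ _ H0), (H0_g_0 _ _ _ _ H0), Cconj_RtoC. ring.
Qed.

(** [harmonic_growth] and [harmonic_expanding] are the hypotheses of
    [strongly_monotone_onto]. The radius [r = |w| / G'], with [G'] halfway between
    [|w|] and [covering_radius], is the one for which [|w| <= G' r]. *)
Lemma harmonic_covers w :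
  Cmod w < covering_radius -> disk_image (harmonic_of h g) w.
Proof.
intros Hw. assert (Hw0 := Cmod_ge_0 w).
set (G' := (Cmod w + covering_radius) / 2).
assert (HG' : Cmod w < G' < covering_radius) by (unfold G'; lra).
set (r := Cmod w / G').
assert (Hr : 0 <= r < 1).
{ unfold r. split; [apply Rdiv_le_0_compat; lra|].
  apply Rmult_lt_reg_r with G'; [lra|]. unfold Rdiv. rewrite Rmult_assoc, Rinv_l; lra. }
destruct (harmonic_expanding r Hr) as [c [Hc Mono]].
destruct (harmonic_lipschitz r Hr) as [L [_ Lip]].
destruct (strongly_monotone_onto (harmonic_of h g) r c L covering_radius G' w)
  as [x [Hx E]]; try assumption; try lra.
- exact harmonic_0.
- intros x Hx. apply harmonic_growth. lra.
- unfold r. right. field. lra.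
- exists x. split; [lra|now symmetry].
Qed.

(** Points of modulus less than [covering_radius] are interior to the image. *)
Lemma harmonic_dist_lower :
  Rbar_le covering_radius
    (dist_to (harmonic_of h g 0) (boundary (disk_image (harmonic_of h g)))).
Proof.
unfold dist_to. apply Glb_Rbar_correct.
intros d [v [[Hv1 _] ->]]. rewrite harmonic_0. replace (v - 0)%C with v by ring.
simpl. destruct (Rle_or_lt covering_radius (Cmod v)) as [Q|Q]; [exact Q|exfalso].
apply Hv1. apply locally_Cmod. exists (covering_radius - Cmod v). split; [lra|].
intros y Hy. apply harmonic_covers.
replace y with (v + (y - v))%C by ring.
eapply Rle_lt_trans; [apply Cmod_triangle|]. lra.
Qed.

Lemma harmonic_injective x y :
  Cmod x < 1 -> Cmod y < 1 -> harmonic_of h g x = harmonic_of h g y -> x = y.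
Proof.
intros Hx Hy E. set (r := Rmax (Cmod x) (Cmod y)).
assert (Hr : 0 <= r < 1).
{ split; [eapply Rle_trans; [apply Cmod_ge_0|apply (Rmax_l _ (Cmod y))]|].
  now apply Rmax_lub_lt. }
destruct (harmonic_expanding r Hr) as [c [Hc Mono]].
specialize (Mono x y (Rmax_l _ _) (Rmax_r _ _)). rewrite E in Mono.
replace (Cconj (x - y) * (harmonic_of h g y - harmonic_of h g y))%C with (RtoC 0) in Mono
  by ring.
rewrite re_RtoC in Mono.
assert (Z : Cmod (x - y)%C = 0).
{ generalize (Cmod_ge_0 (x - y)%C). intros [P|P]; [|now symmetry].
  exfalso. assert (0 < Cmod (x - y)%C ^ 2) by now apply pow_lt. nra. }
apply Cmod_eq_0 in Z. replace x with (x - y + y)%C by ring. rewrite Z. ring.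
Qed.

(** A suitable [e] makes [a_m] and [e b_m] parallel, so that
    [|a_m + e b_m| = |a_m| + |b_m|]. *)
Lemma class_coef_bound m : (2 <= m)%nat ->
  Cmod (a m) + Cmod (b m) <= 4 * (gam - lam) / denom gam del m.
Proof.
intros Hm. destruct m as [|[|k]]; try lia.
destruct (unimodular_phase (a (S (S k)))) as [c1 [Hc1 E1]].
destruct (unimodular_phase (b (S (S k)))) as [c2 [Hc2 E2]].
assert (N : c1 <> RtoC 0).
{ intros F. rewrite F, Cmod_0 in Hc1. lra. }
assert (He : Cmod (c2 / c1)%C = 1) by (rewrite Cmod_div, Hc1, Hc2 by exact N; field).
eapply Rle_trans; [|apply (mixed_coef_bound _ He k)]. unfold mixed_coef. right.
replace (Cmod (a (S (S k)) + c2 / c1 * b (S (S k)))%C)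
  with (Cmod (c1 * (a (S (S k)) + c2 / c1 * b (S (S k))))%C)
  by (rewrite Cmod_mult, Hc1; ring).
replace (c1 * (a (S (S k)) + c2 / c1 * b (S (S k))))%C
  with (c1 * a (S (S k)) + c2 * b (S (S k)))%C by (field; exact N).
rewrite E1, E2, <- RtoC_plus, Cmod_R, Rabs_pos_eq; [reflexivity|].
generalize (Cmod_ge_0 (a (S (S k)))) (Cmod_ge_0 (b (S (S k)))). lra.
Qed.

Lemma harmonic_Cmod_le z : Cmod z < 1 ->
  Cmod (harmonic_of h g z) <=
  Cmod z + Series_from 2 (fun m => (Cmod (a m) + Cmod (b m)) * Cmod z ^ m).
Proof.
intros Hz. rewrite (harmonic_eq z Hz).
rewrite (Cpseries_shift a z Sa Hz), (Cpseries_shift _ z (disk_summable_shift _ Sa) Hz).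
rewrite (Cpseries_shift b z Sb Hz), (Cpseries_shift _ z (disk_summable_shift _ Sb) Hz).
rewrite (proj1 class_coef_h), (proj2 class_coef_h).
rewrite (proj1 class_coef_g), (proj2 class_coef_g).
assert (Sa2 := disk_summable_shift _ (disk_summable_shift _ Sa)).
assert (Sb2 := disk_summable_shift _ (disk_summable_shift _ Sb)).
set (Qa := Cpseries (fun k => a (S (S k))) z). set (Qb := Cpseries (fun k => b (S (S k))) z).
replace (0 + z * (1 + z * Qa) + Cconj (0 + z * (0 + z * Qb)))%C
  with (z + (z ^ 2 * Qa + Cconj (z ^ 2 * Qb)))%C.
2:{ replace (0 + z * (0 + z * Qb))%C with (z ^ 2 * Qb)%C by ring. ring. }
eapply Rle_trans; [apply Cmod_triangle|]. apply Rplus_le_compat_l.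
eapply Rle_trans; [apply Cmod_triangle|]. rewrite Cmod_conj, !Cmod_mult, Cmod_pow.
assert (Hz0 := Cmod_ge_0 z).
assert (Ba := Cpseries_bound _ (Cmod z) z Sa2 ltac:(lra) ltac:(lra)).
assert (Bb := Cpseries_bound _ (Cmod z) z Sb2 ltac:(lra) ltac:(lra)).
fold Qa in Ba. fold Qb in Bb.
rewrite <- Rmult_plus_distr_l.
eapply Rle_trans; [apply Rmult_le_compat_l; [apply pow2_ge_0|apply Rplus_le_compat; eassumption]|].
rewrite <- Series_plus, <- Series_scal_l.
- right. apply Series_ext. intros k. simpl. ring.
- apply Sa2; lra.
- apply Sb2; lra.
Qed.

End Class.
End Family.

(** * The radius equation and the inequality below its root *)

Lemma alternating_sum_bounds (c : nat -> R) n :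
  (forall k, 0 <= c (S k) <= c k) -> 0 <= sum_n (fun k => (-1) ^ k * c k) n <= c O.
Proof.
revert c. induction n as [|n IH]; intros c Hc.
- rewrite sum_O. simpl. generalize (Hc O). lra.
- assert (E : forall m, @eq R (sum_n (fun k => (-1) ^ k * c k) (S m))
      (c O - sum_n (fun k => (-1) ^ k * c (S k)) m)).
  { induction m as [|m IHm].
    - rewrite sum_n_RS, !sum_O. simpl. ring.
    - rewrite sum_n_RS, IHm, sum_n_RS. simpl pow. ring. }
  rewrite E. specialize (IH (fun k => c (S k)) (fun k => Hc (S k))). cbn beta in IH.
  generalize (Hc O). lra.
Qed.

Lemma alternating_Series_bounds (c : nat -> R) :
  (forall k, 0 <= c (S k) <= c k) -> ex_series c ->
  0 <= Series (fun k => (-1) ^ k * c k) <= c O.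
Proof.
intros Hc He.
assert (Hs : ex_series (fun k => (-1) ^ k * c k)).
{ apply (ex_series_le (V := R_CompleteNormedModule)) with (2 := He).
  intros k. change (Rabs ((-1) ^ k * c k) <= c k).
  assert (0 <= c k) by (generalize (Hc k); lra).
  rewrite Rabs_mult, pow_1_abs, (Rabs_pos_eq (c k)); lra. }
assert (L : is_lim_seq (sum_n (fun k => (-1) ^ k * c k)) (Series (fun k => (-1) ^ k * c k)))
  by exact (Series_correct _ Hs).
split.
- apply (is_lim_seq_le (fun _ => 0) _ 0 (Series (fun k => (-1) ^ k * c k)) (fun n =>
    proj1 (alternating_sum_bounds c n Hc)) (is_lim_seq_const 0) L).
- apply (is_lim_seq_le _ (fun _ => c O) (Series (fun k => (-1) ^ k * c k)) (c O) (fun n =>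
    proj2 (alternating_sum_bounds c n Hc)) L (is_lim_seq_const (c O))).
Qed.

Lemma bernoulli_one_minus x n : 0 <= x <= 1 -> 1 - INR n * x <= (1 - x) ^ n.
Proof.
intros Hx. induction n as [|n IH]; [simpl; lra|].
rewrite S_INR. simpl pow.
assert (0 <= INR n * x * x) by (repeat apply Rmult_le_pos; try lra; apply pos_INR).
nra.
Qed.

Lemma pow_lt_1 n r : (1 <= n)%nat -> 0 <= r < 1 -> 0 <= r ^ n < 1.
Proof.
intros Hn Hr. split; [apply pow_le; lra|].
destruct n as [|k]; [lia|]. simpl.
assert (r ^ k <= 1) by (rewrite <- (pow1 k); apply pow_incr; lra).
assert (0 <= r ^ k) by (apply pow_le; lra). nra.
Qed.

Section Sharpness.
Variables gam del lam : R.
Hypothesis (Hlam : 0 <= lam) (Hgam : lam < gam) (Hdel : gam <= del).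

Definition sharp_coef (m : nat) : R := 4 * (gam - lam) / denom gam del m.

Lemma sharp_coef_pos m : (1 <= m)%nat -> 0 < sharp_coef m.
Proof.
intros Hm. apply Rdiv_lt_0_compat; [lra|].
now apply denom_pos with lam.
Qed.

Lemma sharp_coef_summable : ex_series (fun k => sharp_coef (S k)).
Proof.
apply ex_series_ext with (fun k => 4 * (gam - lam) * Rabs (/ denom gam del (S k))).
- intros k. unfold sharp_coef, Rdiv. f_equal. apply Rabs_pos_eq.
  apply Rlt_le, Rinv_0_lt_compat. apply denom_pos with lam; auto; lia.
- apply ex_series_mult_l. now apply ex_series_inv_denom with lam.
Qed.

Lemma sharp_coef_summable_from k :
  (1 <= k)%nat -> ex_series (fun j => sharp_coef (k + j)).
Proof.
intros Hk. destruct k as [|k]; [lia|].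
apply (ex_series_incr_n (fun j => sharp_coef (S j)) k).
apply sharp_coef_summable.
Qed.

(** Let [c k = 1 / d_(k+2)]. The alternating sum of [c] lies strictly between 0
    and [c 0] because [c] is decreasing, and
    [4 (gam - lam) c 0 = (gam - lam) / (gam + del) <= 1/2]. *)
Lemma covering_radius_bounds : 0 < covering_radius gam del lam < 1.
Proof.
unfold covering_radius. rewrite alt_sum_eq.
set (c := fun k => / denom gam del (S (S k))).
assert (Hc : forall k, 0 <= c (S k) <= c k).
{ intros k. unfold c.
  assert (D1 := denom_pos gam del lam Hlam Hgam Hdel (S (S k)) ltac:(lia)).
  assert (D2 := denom_pos gam del lam Hlam Hgam Hdel (S (S (S k))) ltac:(lia)).
  split; [now apply Rlt_le, Rinv_0_lt_compat|].
  apply Rinv_le_contravar; [exact D1|].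
  assert (L := linear_factor_ge gam del Hdel (S (S k)) ltac:(lia)).
  unfold denom in *. rewrite (S_INR (S (S k))).
  assert (N : 0 <= INR (S (S k))) by apply pos_INR.
  set (m := INR (S (S k))) in *.
  apply Rmult_le_compat; [apply pow2_ge_0|lra|apply pow_incr; lra|].
  apply Rplus_le_compat_l, Rmult_le_compat_l; lra. }
assert (He : ex_series (fun k => Rabs (/ denom gam del (S k))))
  by now apply ex_series_inv_denom with lam.
assert (He' : ex_series c).
{ apply ex_series_Rabs. now apply (ex_series_incr_1 (fun k => Rabs (/ denom gam del (S k)))). }
assert (B1 := alternating_Series_bounds c Hc He').
assert (B2 := alternating_Series_bounds (fun k => c (S k)) (fun k => Hc (S k))
   (proj1 (ex_series_incr_1 c) He')). cbn beta in B2.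
assert (E : Series (fun k => (-1) ^ k * c k) = c O - Series (fun k => (-1) ^ k * c (S k))).
{ rewrite Series_incr_1.
  - rewrite (Series_ext _ (fun k => - ((-1) ^ k * c (S k)))).
    + rewrite Series_opp. simpl. ring.
    + intros k. simpl. ring.
  - apply (ex_series_le (V := R_CompleteNormedModule)) with (2 := He').
    intros k. change (Rabs ((-1) ^ k * c k) <= c k).
    assert (0 <= c k) by (generalize (Hc k); lra).
    rewrite Rabs_mult, pow_1_abs, (Rabs_pos_eq (c k)); lra. }
assert (E2 : Series (fun k => (-1) ^ S k * / denom gam del (S (S k)))
             = - Series (fun k => (-1) ^ k * c k)).
{ rewrite <- Series_opp. apply Series_ext. intros k. unfold c. simpl. ring. }
rewrite E2. set (s := Series (fun k => (-1) ^ k * c k)) in *.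
assert (C01 : c 1%nat < c O).
{ unfold c. apply Rinv_lt_contravar.
  - apply Rmult_lt_0_compat; apply denom_pos with lam; auto; lia.
  - unfold denom. simpl. nra. }
assert (C0 : 4 * (gam - lam) * c O <= 1 / 2).
{ unfold c, denom. simpl.
  replace (4 * (gam - lam) * / ((1 + 1) * ((1 + 1) * 1) * (2 * gam + (del - gam) * (1 + 1 - 1))))
    with ((gam - lam) / (gam + del)) by (field; lra).
  apply Rmult_le_reg_r with (gam + del); [lra|].
  unfold Rdiv. rewrite Rmult_assoc, Rinv_l by lra. lra. }
assert (Hs : 0 < s <= c O) by lra.
assert (0 < 4 * (gam - lam)) by lra.
split; nra.
Qed.

Definition majorant_tail (k : nat) (x : R) : R :=
  Series_from k (fun m => sharp_coef m * x ^ m).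

Lemma majorant_tail_ex k x : (1 <= k)%nat -> 0 <= x <= 1 ->
  ex_series (fun j => sharp_coef (k + j) * x ^ (k + j)).
Proof.
intros Hk Hx. apply ex_series_nonneg_le with (2 := sharp_coef_summable_from k Hk).
intros j. assert (P := sharp_coef_pos (k + j) ltac:(lia)).
assert (0 <= x ^ (k + j) <= 1).
{ split; [apply pow_le; lra|]. rewrite <- (pow1 (k + j)). apply pow_incr; lra. }
nra.
Qed.

Lemma majorant_tail_mono k x y : (1 <= k)%nat -> 0 <= x <= y -> y <= 1 ->
  majorant_tail k x <= majorant_tail k y.
Proof.
intros Hk Hx Hy. apply Series_le; [|apply majorant_tail_ex; [exact Hk|lra]].
intros j. assert (P := sharp_coef_pos (k + j) ltac:(lia)).
assert (0 <= x ^ (k + j) <= y ^ (k + j)).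
{ split; [apply pow_le; lra|]. apply pow_incr; lra. }
split; [|apply Rmult_le_compat_l; lra]. apply Rmult_le_pos; lra.
Qed.

Lemma majorant_tail_0 k : (1 <= k)%nat -> majorant_tail k 0 = 0.
Proof.
intros Hk. unfold majorant_tail, Series_from.
rewrite (Series_ext _ (fun j => 0 * 0)).
- rewrite Series_scal_l. ring.
- intros j. rewrite pow_i by lia. ring.
Qed.

(** Factoring out [x^k] leaves a power series with bounded coefficients. *)
Lemma majorant_tail_continuity k x : (1 <= k)%nat -> Rabs x < 1 ->
  continuity_pt (majorant_tail k) x.
Proof.
intros Hk Hx.
apply continuity_pt_ext with
  (fun y => y ^ k * PSeries (fun j => sharp_coef (k + j)) y).
- intros y. unfold PSeries, majorant_tail, Series_from.
  rewrite <- Series_scal_l. apply Series_ext. intros j. rewrite pow_add. ring.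
- apply continuity_pt_mult; [apply derivable_continuous_pt, derivable_pt_pow|].
  apply PSeries_continuity, bounded_CV_radius; [|exact Hx].
  exists (Series (fun j => sharp_coef (k + j))). intros j.
  assert (P : forall i, 0 <= sharp_coef (k + i))
    by (intros i; apply Rlt_le, sharp_coef_pos; lia).
  rewrite Rabs_pos_eq by apply P.
  apply (term_le_Series _ j P (sharp_coef_summable_from k Hk)).
Qed.

Lemma radius_function_eq n N r :
  radius_function n N gam del lam r
  = r ^ n + majorant_tail 2 (r ^ n) + majorant_tail N r - covering_radius gam del lam.
Proof.
unfold radius_function, majorant_tail, covering_radius, alt_sum, Series_from.
rewrite (Series_ext
  (fun j => (fun m => 4 * (gam - lam) * r ^ (n * m) / denom gam del m) (2 + j)%nat)
  (fun j => sharp_coef (2 + j) * (r ^ n) ^ (2 + j))).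
2:{ intros j. rewrite <- pow_mult. unfold sharp_coef, Rdiv. ring. }
rewrite (Series_ext
  (fun j => (fun m => 4 * (gam - lam) * r ^ m / denom gam del m) (N + j)%nat)
  (fun j => sharp_coef (N + j) * r ^ (N + j))).
2:{ intros j. unfold sharp_coef, Rdiv. ring. }
ring.
Qed.

Section Indices.
Variables n N : nat.
Hypothesis (Hn : (1 <= n)%nat) (HN : (2 <= N)%nat).

Lemma radius_function_lt r s : 0 <= r < s -> s < 1 ->
  radius_function n N gam del lam r < radius_function n N gam del lam s.
Proof.
intros Hr Hs. rewrite !radius_function_eq.
assert (P : r ^ n < s ^ n).
{ destruct n as [|k]; [lia|]. simpl.
  assert (0 <= r ^ k <= s ^ k) by (split; [apply pow_le; lra|apply pow_incr; lra]).
  assert (0 < s ^ k) by (apply pow_lt; lra). nra. }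
assert (P0 := pow_lt_1 n r Hn ltac:(lra)). assert (P1 := pow_lt_1 n s Hn ltac:(lra)).
assert (M1 := majorant_tail_mono 2 (r ^ n) (s ^ n) ltac:(lia) ltac:(lra) ltac:(lra)).
assert (M2 := majorant_tail_mono N r s ltac:(lia) ltac:(lra) ltac:(lra)). lra.
Qed.

(** Intermediate value theorem on [[0, r1]], where [r1 < 1] is chosen by
    Bernoulli's inequality so that already [r1^n > covering_radius], and [[0, r1]]
    lies inside the disk of convergence. *)
Lemma radius_root_exists : exists r, is_radius_root n N gam del lam r.
Proof.
assert (G := covering_radius_bounds). set (cov := covering_radius gam del lam) in *.
assert (Hn1 : 1 <= INR n) by (apply (le_INR 1); exact Hn).
set (x := (1 - cov) / (2 * INR n)).
assert (Hx : 0 < x < 1 /\ INR n * x = (1 - cov) / 2).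
{ unfold x. repeat split.
  - apply Rdiv_lt_0_compat; lra.
  - apply Rmult_lt_reg_r with (2 * INR n); [lra|]. unfold Rdiv.
    rewrite Rmult_assoc, Rinv_l by lra. lra.
  - field. lra. }
set (r1 := 1 - x). assert (Hr1 : 0 < r1 < 1) by (unfold r1; lra).
assert (B := bernoulli_one_minus x n ltac:(lra)). fold r1 in B.
assert (P1 := pow_lt_1 n r1 Hn ltac:(lra)).
assert (V1 : 0 < radius_function n N gam del lam r1).
{ rewrite radius_function_eq. fold cov.
  assert (M1 := majorant_tail_mono 2 0 (r1 ^ n) ltac:(lia) ltac:(lra) ltac:(lra)).
  assert (M2 := majorant_tail_mono N 0 r1 ltac:(lia) ltac:(lra) ltac:(lra)).
  rewrite majorant_tail_0 in M1, M2 by lia. lra. }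
assert (V0 : radius_function n N gam del lam 0 < 0).
{ rewrite radius_function_eq, pow_i by lia. fold cov.
  rewrite !majorant_tail_0 by lia. lra. }
destruct (Ranalysis5.IVT_interv (fun r => radius_function n N gam del lam r) 0 r1)
  as [r [Hr E]]; [|lra|exact V0|exact V1|].
- intros r Hr.
  apply continuity_pt_ext with
    (fun r => r ^ n + majorant_tail 2 (r ^ n) + majorant_tail N r - cov).
  { intros y. symmetry. apply radius_function_eq. }
  assert (P := pow_lt_1 n r Hn ltac:(lra)).
  assert (C1 : continuity_pt (fun r => r ^ n) r)
    by (apply derivable_continuous_pt, derivable_pt_pow).
  apply continuity_pt_minus; [|apply continuity_pt_const; now intros ? ?].
  apply continuity_pt_plus; [apply continuity_pt_plus; [exact C1|]|].
  + apply (continuity_pt_comp (fun r => r ^ n) (majorant_tail 2)); [exact C1|].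
    apply majorant_tail_continuity; [lia|]. rewrite Rabs_pos_eq; lra.
  + apply majorant_tail_continuity; [lia|]. rewrite Rabs_pos_eq; lra.
- exists r. split; [|exact E].
  split; [|lra]. destruct (Req_dec r 0) as [F|F]; [|lra].
  rewrite F in E. lra.
Qed.

(** The coefficient bound majorizes the left-hand side by
    [radius_function + covering_radius], which is at most [covering_radius] up to
    the root. *)
Lemma bohr_inequality_below_root (h g : C -> C) (a b : nat -> C) rho z :
  class_RH0 gam del lam h g a b -> is_radius_root n N gam del lam rho ->
  Cmod z <= rho -> bohr_inequality n N h g a b z.
Proof.
intros Hf [Hrho Hroot] Hz. unfold bohr_inequality.
eapply Rbar_le_trans; [|exact (harmonic_dist_lower gam del lam Hlam Hgam Hdel h g a b Hf)].
simpl. set (r := Cmod z) in *. assert (Hr0 : 0 <= r) by apply Cmod_ge_0.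
assert (P := pow_lt_1 n r Hn ltac:(lra)).
assert (Hzn : Cmod (z ^ n)%C = r ^ n) by apply Cmod_pow.
assert (U1 := harmonic_Cmod_le gam del lam h g a b Hf (z ^ n)%C ltac:(lra)).
rewrite Hzn in U1.
assert (Coef := class_coef_bound gam del lam Hlam Hgam Hdel h g a b Hf).
assert (Tail : forall k x, (2 <= k)%nat -> 0 <= x < 1 ->
   Series_from k (fun m => (Cmod (a m) + Cmod (b m)) * x ^ m) <= majorant_tail k x).
{ intros k x Hk Hx. apply Series_le; [|apply majorant_tail_ex; [lia|lra]].
  intros j. assert (0 <= x ^ (k + j)) by (apply pow_le; lra).
  generalize (Cmod_ge_0 (a (k + j)%nat)) (Cmod_ge_0 (b (k + j)%nat)). intros.
  split; [apply Rmult_le_pos; lra|]. apply Rmult_le_compat_r; [easy|].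
  apply Coef. lia. }
assert (T1 := Tail 2%nat (r ^ n) ltac:(lia) P). assert (T2 := Tail N r HN ltac:(lra)).
assert (R0 : radius_function n N gam del lam r <= 0).
{ destruct (Req_dec r rho) as [->|F]; [lra|].
  generalize (radius_function_lt r rho ltac:(lra) ltac:(lra)). lra. }
rewrite radius_function_eq in R0. lra.
Qed.

End Indices.

(** * The extremal map *)

Definition extremal_coef (m : nat) : R :=
  match m with O => 0 | 1%nat => 1 | _ => sharp_coef m end.

Definition extremal_map : C -> C := Cpseries (fun m => RtoC (extremal_coef m)).

Lemma extremal_coef_abs_summable : ex_series (fun m => Rabs (extremal_coef m)).
Proof.
apply ex_series_incr_1, ex_series_incr_1.
apply ex_series_ext with (fun k => sharp_coef (2 + k)).
- intros k. simpl. symmetry. apply Rabs_pos_eq. apply Rlt_le, sharp_coef_pos. lia.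
- apply sharp_coef_summable_from. lia.
Qed.

Lemma extremal_summable : disk_summable (fun m => RtoC (extremal_coef m)).
Proof.
intros r Hr. apply ex_series_nonneg_le with (2 := extremal_coef_abs_summable).
intros m. rewrite Cmod_R. assert (0 <= r ^ m <= 1).
{ split; [apply pow_le; lra|]. rewrite <- (pow1 m). apply pow_incr; lra. }
generalize (Rabs_pos (extremal_coef m)). nra.
Qed.

Lemma extremal_expansion : power_expansion extremal_map (fun m => RtoC (extremal_coef m)).
Proof.
apply power_expansion_iff. intros z Hz. apply is_Cpseries; [apply extremal_summable|exact Hz].
Qed.

Lemma zero_expansion : power_expansion (fun _ => RtoC 0) (fun _ => RtoC 0).
Proof.
apply power_expansion_iff. intros z Hz.
eapply is_Cseries_ext; [|now apply (is_Cseries_single (fun _ => RtoC 0) 0)]. intros k. cbn beta. ring.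
Qed.

(** All coefficients of [op] on the extremal map beyond the first equal
    [2 (gam - lam)], so that [op - lam] is [gam - lam] times the half-plane map. *)
Lemma extremal_op z : Cmod z < 1 ->
  third_order_op gam del extremal_map z
  = (lam + (gam - lam) * ((1 + z) / (1 - z)))%C.
Proof.
intros Hz.
rewrite (power_expansion_eq _ _ z (third_order_op_expansion gam del _ _ extremal_expansion) Hz).
apply is_Cseries_unique.
assert (S1 := is_Cseries_single (fun k => match k with O => RtoC lam | S _ => RtoC 0 end) 0
  ltac:(now intros [|k] Hk)).
eapply is_Cseries_ext; [|apply is_Cseries_plus; [exact S1|
  apply (is_Cseries_scal (gam - lam)), (is_Cseries_poisson z Hz)]].
intros k. cbn beta. unfold op_coef. destruct k as [|k].
- replace (denom gam del 1 / 2) with gam by (unfold denom; simpl; field).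
  simpl. ring.
- assert (D := denom_pos gam del lam Hlam Hgam Hdel (S (S k)) ltac:(lia)).
  rewrite <- (RtoC_mult _ (extremal_coef _)). simpl extremal_coef. simpl poisson_coef.
  replace (denom gam del (S (S k)) / 2 * sharp_coef (S (S k)))
    with ((gam - lam) * 2) by (unfold sharp_coef; field; lra).
  rewrite RtoC_mult, RtoC_minus. ring.
Qed.

Lemma extremal_in_class :
  class_RH0 gam del lam extremal_map (fun _ => RtoC 0)
    (fun m => RtoC (extremal_coef m)) (fun _ => RtoC 0).
Proof.
assert (Z01 : Cmod (RtoC 0) < 1) by (rewrite Cmod_0; lra).
split.
- constructor.
  + intros z Hz. eexists. apply Cpseries_is_derive; [apply extremal_summable|exact Hz].
  + intros z Hz. apply ex_derive_const.
  + unfold extremal_map. now rewrite Cpseries_0.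
  + rewrite (C_derive_power_expansion _ _ _ extremal_expansion Z01), Cpseries_0.
    unfold Cderiv_coef. simpl. ring.
  + reflexivity.
  + rewrite (C_derive_power_expansion _ _ _ zero_expansion Z01), Cpseries_0.
    unfold Cderiv_coef. ring.
  + apply extremal_expansion.
  + apply zero_expansion.
- intros z Hz. rewrite (extremal_op z Hz).
  assert (E : third_order_op gam del (fun _ => RtoC 0) z = RtoC 0).
  { rewrite (power_expansion_eq _ _ z (third_order_op_expansion gam del _ _ zero_expansion) Hz).
    apply is_Cseries_unique. assert (H := zero_expansion). rewrite power_expansion_iff in H.
    eapply is_Cseries_ext; [|apply (H z Hz)]. intros k. cbn beta. unfold op_coef. ring. }
  rewrite E, Cmod_0.
  replace (lam + (gam - lam) * ((1 + z) / (1 - z)) - lam)%C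
    with (RtoC (gam - lam) * ((1 + z) / (1 - z)))%C by (rewrite RtoC_minus; ring).
  rewrite re_scal_l. assert (B := poisson_Re_bound z Hz).
  assert (0 < (1 - Cmod z) / (1 + Cmod z)).
  { generalize (Cmod_ge_0 z). intros. apply Rdiv_lt_0_compat; lra. }
  apply Rmult_lt_0_compat; lra.
Qed.

Let fext := harmonic_of extremal_map (fun _ => RtoC 0).

Lemma extremal_harmonic z : fext z = extremal_map z.
Proof. unfold fext, harmonic_of. rewrite Cconj_RtoC. ring. Qed.

Lemma extremal_real x : Rabs x < 1 -> fext x = RtoC (PSeries extremal_coef x).
Proof.
intros Hx. rewrite extremal_harmonic. apply C_eq.
- apply Series_ext. intros k. rewrite <- RtoC_pow, <- RtoC_mult. apply re_RtoC.
- change (Series (fun k => Im (RtoC (extremal_coef k) * RtoC x ^ k)%C) = 0).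
  rewrite (Series_ext _ (fun _ => 0 * 0)).
  + rewrite Series_scal_l. ring.
  + intros k. rewrite <- RtoC_pow, <- RtoC_mult. unfold Im; simpl; ring.
Qed.

Lemma extremal_conj z : Cmod z < 1 -> fext (Cconj z) = Cconj (fext z).
Proof.
intros Hz. rewrite !extremal_harmonic. unfold extremal_map. apply is_Cseries_unique.
eapply is_Cseries_ext; [|apply is_Cseries_conj, (is_Cpseries _ z extremal_summable Hz)].
intros k. cbn beta. now rewrite Cmult_conj, Cpow_conj, Cconj_RtoC.
Qed.

Lemma extremal_pos_axis x : 0 <= x < 1 ->
  PSeries extremal_coef x = x + majorant_tail 2 x.
Proof.
intros Hx. unfold PSeries.
assert (He : ex_series (fun k => extremal_coef k * x ^ k)).
{ apply ex_series_Rabs, (CV_disk_inside extremal_coef x).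
  apply bounded_CV_radius; [|rewrite Rabs_pos_eq; lra].
  exists (Series (fun m => Rabs (extremal_coef m))). intros k.
  apply (term_le_Series (fun m => Rabs (extremal_coef m)) k
     (fun m => Rabs_pos _) extremal_coef_abs_summable). }
rewrite Series_incr_1 by exact He. rewrite Series_incr_1 by now apply (ex_series_incr_1 (fun k => extremal_coef k * x ^ k)).
simpl extremal_coef at 1 2.
replace (0 * x ^ 0 + (1 * x ^ 1 + Series (fun k => extremal_coef (S (S k)) * x ^ S (S k))))
  with (x + Series (fun k => extremal_coef (S (S k)) * x ^ S (S k))) by (simpl; ring).
reflexivity.
Qed.

Lemma extremal_value_at_minus_one :
  Series (fun k => extremal_coef k * (-1) ^ k) = - covering_radius gam del lam.
Proof.
assert (He : ex_series (fun k => extremal_coef k * (-1) ^ k)).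
{ apply ex_series_Rabs. apply ex_series_ext with (2 := extremal_coef_abs_summable).
  intros k. now rewrite Rabs_mult, pow_1_abs, Rmult_1_r. }
rewrite Series_incr_1 by exact He. rewrite Series_incr_1 by now apply (ex_series_incr_1 (fun k => extremal_coef k * (-1) ^ k)).
unfold covering_radius. rewrite alt_sum_eq, <- Series_scal_l.
rewrite (Series_ext (fun k => extremal_coef (S (S k)) * (-1) ^ S (S k))
  (fun k => - (4 * (gam - lam) * ((-1) ^ S k * / denom gam del (S (S k)))))).
- rewrite Series_opp. simpl extremal_coef at 1 2. simpl pow at 1 2. ring.
- intros k. simpl. unfold sharp_coef, Rdiv. ring.
Qed.

Lemma extremal_tends_to_minus_one eps : 0 < eps ->
  exists eta, 0 <= eta < 1 /\ forall s, eta < s < 1 ->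
    Rabs (PSeries extremal_coef (- s) + covering_radius gam del lam) < eps.
Proof.
intros He.
destruct (PSeries_radial_limit (fun k => extremal_coef k * (-1) ^ k)) with eps
  as [eta [H1 H2]]; [|exact He|].
- apply ex_series_ext with (2 := extremal_coef_abs_summable).
  intros k. now rewrite Rabs_mult, pow_1_abs, Rmult_1_r.
- exists eta. split; [exact H1|]. intros s Hs. specialize (H2 s Hs).
  rewrite extremal_value_at_minus_one in H2.
  replace (PSeries extremal_coef (- s)) with (PSeries (fun k => extremal_coef k * (-1) ^ k) s).
  + now replace (PSeries (fun k => extremal_coef k * (-1) ^ k) s + covering_radius gam del lam)
      with (PSeries (fun k => extremal_coef k * (-1) ^ k) s - - covering_radius gam del lam)
      by ring.
  + apply Series_ext. intros k. replace (- s) with (-1 * s) by ring.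
    rewrite Rpow_mult_distr. ring.
Qed.

Lemma extremal_increasing x y : -1 < x -> x <= y -> y < 1 ->
  PSeries extremal_coef x <= PSeries extremal_coef y.
Proof.
intros Hx Hxy Hy.
set (r := Rmax (Rabs x) (Rabs y)).
assert (Rx : Rabs x < 1) by (apply Rabs_def1; lra).
assert (Ry : Rabs y < 1) by (apply Rabs_def1; lra).
assert (Hr : 0 <= r < 1).
{ split; [eapply Rle_trans; [apply Rabs_pos|apply (Rmax_l _ (Rabs y))]|].
  now apply Rmax_lub_lt. }
destruct (harmonic_expanding gam del lam Hlam Hgam Hdel _ _ _ _ extremal_in_class r Hr)
  as [c [Hc Mono]].
specialize (Mono y x). rewrite !Cmod_R in Mono.
specialize (Mono (Rmax_r _ _) (Rmax_l _ _)).
fold fext in Mono. rewrite !extremal_real in Mono by assumption.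
rewrite <- !RtoC_minus, Cmod_R in Mono.
rewrite Cconj_RtoC, <- RtoC_mult, re_RtoC in Mono.
destruct (Req_dec x y) as [->|F]; [lra|].
assert (0 < Rabs (y - x)) by (apply Rabs_pos_lt; lra).
assert (0 < Rabs (y - x) ^ 2) by now apply pow_lt.
assert (0 < c * Rabs (y - x) ^ 2) by now apply Rmult_lt_0_compat.
nra.
Qed.

(** A value below [- covering_radius] at [x] would persist on [(-1, x]] by
    monotonicity and contradict the limit at [-1]. *)
Lemma extremal_ge_neg_axis x : -1 < x < 1 ->
  - covering_radius gam del lam <= PSeries extremal_coef x.
Proof.
intros Hx.
destruct (Rle_or_lt (- covering_radius gam del lam) (PSeries extremal_coef x)) as [Q|Q];
  [exact Q|exfalso].
destruct (extremal_tends_to_minus_one (- covering_radius gam del lam - PSeries extremal_coef x)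
  ltac:(lra)) as [eta [He Hs]].
set (s := (1 + Rmax eta (- x)) / 2).
assert (M1 := Rmax_l eta (- x)). assert (M2 := Rmax_r eta (- x)).
assert (M3 : Rmax eta (- x) < 1) by (apply Rmax_lub_lt; lra).
specialize (Hs s ltac:(unfold s; lra)).
assert (I := extremal_increasing (- s) x ltac:(unfold s; lra) ltac:(unfold s; lra) ltac:(lra)).
apply Rabs_def2 in Hs. lra.
Qed.

(** A preimage of a real point is fixed by conjugation, by injectivity, hence is
    real; so real points just below [- covering_radius] are omitted. Values at
    [-s] with [s] tending to 1 show that the point is in the closure. *)
Lemma extremal_boundary_point :
  boundary (disk_image fext) (RtoC (- covering_radius gam del lam)).
Proof.
split.
- intros L. apply locally_Cmod in L. destruct L as [d [Hd H]].
  destruct (H (RtoC (- covering_radius gam del lam - d / 2))) as [z [Hz E]].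
  { rewrite <- RtoC_minus, Cmod_R, Rabs_left; lra. }
  assert (Hzr : Cconj z = z).
  { apply (harmonic_injective gam del lam Hlam Hgam Hdel _ _ _ _ extremal_in_class).
    - now rewrite Cmod_conj.
    - exact Hz.
    - fold fext. rewrite extremal_conj, <- E by exact Hz. apply Cconj_RtoC. }
  assert (Ez : z = RtoC (Re z)).
  { apply C_eq; [now rewrite re_RtoC|]. apply (f_equal Im) in Hzr.
    rewrite im_conj in Hzr. simpl. lra. }
  rewrite Ez, Cmod_R in Hz. rewrite Ez, extremal_real in E by exact Hz.
  apply RtoC_inj in E. apply Rabs_def2 in Hz.
  generalize (extremal_ge_neg_axis (Re z) ltac:(lra)). lra.
- intros L. apply locally_Cmod in L. destruct L as [d [Hd H]].
  destruct (extremal_tends_to_minus_one d Hd) as [eta [He Hs]].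
  set (s := (1 + eta) / 2).
  assert (Rs : Rabs (- s) < 1) by (apply Rabs_def1; unfold s; lra).
  specialize (Hs s ltac:(unfold s; lra)).
  apply (H (RtoC (PSeries extremal_coef (- s)))).
  + rewrite <- RtoC_minus, Cmod_R.
    now replace (PSeries extremal_coef (- s) - - covering_radius gam del lam)
      with (PSeries extremal_coef (- s) + covering_radius gam del lam) by ring.
  + exists (RtoC (- s)). split; [now rewrite Cmod_R|]. now rewrite extremal_real.
Qed.

Lemma extremal_dist_upper :
  Rbar_le (dist_to (fext 0) (boundary (disk_image fext))) (covering_radius gam del lam).
Proof.
unfold dist_to. apply Glb_Rbar_correct.
exists (RtoC (- covering_radius gam del lam)). split; [apply extremal_boundary_point|].
unfold fext. rewrite (harmonic_0 _ _ _ _ _ _ _ extremal_in_class).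
replace (RtoC (- covering_radius gam del lam) - 0)%C
  with (RtoC (- covering_radius gam del lam)) by ring.
rewrite Cmod_R, Rabs_Ropp, Rabs_pos_eq; [reflexivity|].
generalize covering_radius_bounds. lra.
Qed.

(** On the positive axis the majorant is attained: the left-hand side equals
    [radius_function + covering_radius]. *)
Lemma bohr_inequality_fails_above_root n N rho r :
  (1 <= n)%nat -> (2 <= N)%nat -> is_radius_root n N gam del lam rho ->
  rho < r < 1 ->
  ~ bohr_inequality n N extremal_map (fun _ => RtoC 0)
      (fun m => RtoC (extremal_coef m)) (fun _ => RtoC 0) r.
Proof.
intros Hn HN [Hrho Hroot] Hr Hb. unfold bohr_inequality in Hb.
assert (X := Rbar_le_trans _ _ _ Hb extremal_dist_upper). simpl in X.
fold fext in X.
assert (P := pow_lt_1 n r Hn ltac:(lra)).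
assert (M := majorant_tail_mono 2 0 (r ^ n) ltac:(lia) ltac:(lra) ltac:(lra)).
rewrite majorant_tail_0 in M by lia.
rewrite <- RtoC_pow, extremal_real, Cmod_R, extremal_pos_axis in X
  by (try rewrite Rabs_pos_eq; lra).
rewrite Rabs_pos_eq in X by lra.
replace (Series_from N _) with (majorant_tail N r) in X.
- assert (L := radius_function_lt n N Hn HN rho r ltac:(lra) ltac:(lra)).
  rewrite (radius_function_eq n N r) in L. lra.
- apply Series_ext. intros j. rewrite Cmod_0, !Cmod_R, (Rabs_pos_eq r) by lra.
  rewrite Rplus_0_r. f_equal.
  replace (extremal_coef (N + j)) with (sharp_coef (N + j)).
  + symmetry. apply Rabs_pos_eq, Rlt_le, sharp_coef_pos. lia.
  + destruct N as [|[|N']]; try lia. reflexivity.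
Qed.

End Sharpness.

Theorem theorem4p1 :
  forall (n N : nat) (gam del lam : R),
  (1 <= n)%nat -> (2 <= N)%nat ->
  0 <= lam -> lam < gam -> gam <= del ->
  (exists! rho : R, is_radius_root n N gam del lam rho) /\
  (forall rho : R, is_radius_root n N gam del lam rho ->
     bohr_holds_up_to n N gam del lam rho /\
     (forall rho' : R, rho < rho' -> ~ bohr_holds_up_to n N gam del lam rho')).
Proof.
intros n N gam del lam Hn HN Hlam Hgam Hdel. split.
- destruct (radius_root_exists gam del lam Hlam Hgam Hdel n N Hn HN) as [r Hr].
  exists r. split; [exact Hr|]. intros s Hs.
  destruct Hr as [Hr Er], Hs as [Hs Es].
  destruct (Rtotal_order r s) as [L|[L|L]]; [exfalso|exact L|exfalso].
  + generalize (radius_function_lt gam del lam Hlam Hgam Hdel n N Hn HN r s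
      ltac:(lra) ltac:(lra)). lra.
  + generalize (radius_function_lt gam del lam Hlam Hgam Hdel n N Hn HN s r
      ltac:(lra) ltac:(lra)). lra.
- intros rho Hrho. split.
  + intros h g a b Hf z _ Hz.
    now apply (bohr_inequality_below_root gam del lam) with rho.
  + intros rho' Hlt Hb.
    set (r := (rho + Rmin rho' 1) / 2).
    assert (H1 := Rmin_l rho' 1). assert (H2 := Rmin_r rho' 1).
    assert (H3 : rho < Rmin rho' 1) by (destruct Hrho; apply Rmin_glb_lt; lra).
    assert (Hr : rho < r < 1) by (unfold r; lra).
    assert (Hr0 : 0 < r) by (destruct Hrho; lra).
    apply (bohr_inequality_fails_above_root gam del lam Hlam Hgam Hdel n N rho r Hn HN Hrho Hr).
    apply Hb.
    * now apply extremal_in_class.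
    * rewrite Cmod_R, Rabs_pos_eq; lra.
    * rewrite Cmod_R, Rabs_pos_eq; unfold r in *; lra.
Qed.
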